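(* Let $d\ge1$ be an integer. (1) Let $(\mathbb X,\mathfrak A,\mu)$ be a probability space, $f:\mathbb X\to\mathbb X$ a measure-preserving map, and $\mathcal A:\mathbb X\to\mathrm{HSp}(2d)$ a measurable map such that $x\mapsto\ln\|\mathcal A(x)\|$ is $\mu$-integrable. Then $$\int_0^1 L^d(f,\mathcal R_\theta\mathcal A)\,d\theta\,=\,\int_{\mathbb X}N_d(\mathcal A(x))\,d\mu(x),$$ where $\mathcal R_\theta\mathcal A$ denotes the map $x\mapsto\mathcal R_\theta\mathcal A(x)$. (2) Let $n\ge 1$ and $\mathcal T_1,\ldots,\mathcal T_n\in\mathrm{HSp}(2d)$. Then $$\int_0^1 N_d(\mathcal R_\theta\mathcal T_1\mathcal R_\theta\mathcal T_2\cdots\mathcal R_\theta\mathcal T_n)\,d\theta=\sum_{j=1}^nN_d(\mathcal T_j)$$ and $$\int_0^1\ln\Big(\rho\big(\Lambda^d(\mathcal R_\theta\mathcal T_1\mathcal R_\theta\mathcal T_2\cdots\mathcal R_\theta\mathcal T_n)\big)\Big)\,d\theta=\sum_{j=1}^nN_d(\mathcal T_j),$$ where $\rho(\cdot)$ denotes the spectral radius and $\Lambda^d$ the $d$-th exterior power.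
   Context: $\mathrm{HSp}(2d)=\{\mathcal T\in\mathrm{Mat}(2d,\mathbb C):\mathcal T^*\mathcal J\mathcal T=\mathcal J\}$ with $\mathcal J=\begin{pmatrix}0&\mathbf 1_d\\-\mathbf 1_d&0\end{pmatrix}$, where $\mathbf 1_d$ is the $d\times d$ identity matrix and ${}^*$ is conjugate transpose. For $\theta\in[0,1]$, $$\mathcal R_\theta=\begin{pmatrix}\cos(\pi\theta)\mathbf 1_d&-\sin(\pi\theta)\mathbf 1_d\\ \sin(\pi\theta)\mathbf 1_d&\cos(\pi\theta)\mathbf 1_d\end{pmatrix}\in\mathrm{HSp}(2d).$$ $f$ measure-preserving means $\int_{\mathbb X} g(f(x))\,d\mu(x)=\int_{\mathbb X} g(x)\,d\mu(x)$ for all $g\in L^1(d\mu)$ (not necessarily invertible). $\|\cdot\|$ is the operator norm, and $\sigma_1(\mathcal T)\ge\sigma_2(\mathcal T)\ge\dots$ are the singular values of a matrix $\mathcal T$. For a measurable invertible-matrix-valued map $\mathcal A$ on $\mathbb X$ with suitable log-integrability, put $\mathcal A_n(x)=\mathcal A(f^{n-1}(x))\cdots\mathcal A(f(x))\mathcal A(x)$. The Lyapunov exponents are $L_k(f,\mathcal A)=\lim_{n\to\infty}\frac1n\int_{\mathbb X}\ln\sigma_k(\mathcal A_n(x))\,d\mu(x)$, and $L^k(f,\mathcal A)=\sum_{j=1}^k L_j(f,\mathcal A)=\lim_{n\to\infty}\frac1n\int_{\mathbb X}\ln\|\Lambda^k\mathcal A_n(x)\|\,d\mu(x)$. (For $\mathcal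 A$ with values in $\mathrm{HSp}(2d)$ and $\ln\|\mathcal A(\cdot)\|\in L^1(d\mu)$ these limits exist.) For $\mathcal T\in \mathrm{GL}(m,\mathbb C)$ and $1\le r\le m$, $N_r(\mathcal T)=\sum_{i=1}^r\ln\left(\frac{\sigma_i(\mathcal T)+\sigma_i(\mathcal T)^{-1}}{2}\right)$. *)

(* Defs.v *)
From mathcomp Require Import all_boot all_order all_algebra.
From mathcomp Require Import all_classical all_reals all_analysis.
From mathcomp Require Import complex.

Set Implicit Arguments.
Unset Strict Implicit.
Unset Printing Implicit Defensive.
Import Order.TTheory GRing.Theory Num.Theory.
Import numFieldNormedType.Exports.
Local Open Scope classical_set_scope.
Local Open Scope sesquilinear_scope.
Local Open Scope ring_scope.

(* 2d x 2d matrices have type 'M_(d + d), so that block_mx applies directly. *)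
Definition symplJ (R : realType) (d : nat) : 'M[R[i]]_(d + d) :=
  block_mx 0 1%:M (- 1%:M) 0.

Definition HSp (R : realType) (d : nat) : set 'M[R[i]]_(d + d) :=
  [set T | T ^t* *m symplJ R d *m T = symplJ R d].

Definition rotmx (R : realType) (d : nat) (theta : R) : 'M[R[i]]_(d + d) :=
  let c := (cos (pi * theta))%:C%C in
  let s := (sin (pi * theta))%:C%C in
  block_mx c%:M (- s%:M) s%:M c%:M.

Definition l2norm (R : realType) (m : nat) (v : 'cV[R[i]]_m) : R :=
  Num.sqrt (\sum_(i < m) ComplexField.Normc.normc (v i 0) ^+ 2).

Definition opnorm (R : realType) (m : nat) (T : 'M[R[i]]_m) : R :=
  sup [set l2norm (T *m v) | v in [set v : 'cV[R[i]]_m | l2norm v <= 1]].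

(* T^* T is normal, so [spectral_diag] lists its eigenvalues with
   multiplicity, in no specified order; they are real and nonnegative.
   The index is 0-based: [singval T k] is sigma_(k+1) (T). *)
Definition singvals (R : realType) (m : nat) (T : 'M[R[i]]_m) : seq R :=
  sort >=%R [seq Num.sqrt (complex.Re (spectral_diag (T ^t* *m T) 0 i))
            | i <- enum 'I_m].

Definition singval (R : realType) (m : nat) (T : 'M[R[i]]_m) (k : nat) : R :=
  (singvals T)`_k.

Definition Nsum (R : realType) (m r : nat) (T : 'M[R[i]]_m) : R :=
  \sum_(i < r) ln ((singval T i + (singval T i)^-1) / 2).

Definition ltn_tuples (k m : nat) : {set k.-tuple 'I_m} :=
  [set t : k.-tuple 'I_m | sorted ltn [seq val i | i <- t]]%SET.

(* The matrix of Lambda^k T in the orthonormal basis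
   e_I = e_(i_1) /\ ... /\ e_(i_k), i_1 < ... < i_k, of Lambda^k C^m:
   its (I, J) entry is the coefficient
   < e_I, T e_(j_1) /\ ... /\ T e_(j_k) > = det (T_(i_a, j_b))_(a, b). *)
Definition extpow (R : realType) (m k : nat) (T : 'M[R[i]]_m) :
    'M[R[i]]_#|ltn_tuples k m| :=
  \matrix_(I, J) \det (mxsub (tnth (enum_val I)) (tnth (enum_val J)) T).

Definition specrad (R : realType) (m : nat) (T : 'M[R[i]]_m) : R :=
  sup [set ComplexField.Normc.normc z | z in [set z : R[i] | eigenvalue T z]].

Definition measurable_mx (R : realType) (dX : measure_display)
    (X : measurableType dX) (m : nat) (A : X -> 'M[R[i]]_m) : Prop :=
  forall i j, measurable_fun setT (fun x => complex.Re (A x i j)) /\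
              measurable_fun setT (fun x => complex.Im (A x i j)).

Definition measure_preserving (R : realType) (dX : measure_display)
    (X : measurableType dX) (mu : {measure set X -> \bar R}) (f : X -> X) :
    Prop :=
  measurable_fun setT f /\
  forall g : X -> R, mu.-integrable setT (EFin \o g) ->
    (\int[mu]_x (g (f x))%:E = \int[mu]_x (g x)%:E)%E.

Fixpoint cocycle (R : realType) (X : Type) (m : nat) (f : X -> X)
    (A : X -> 'M[R[i]]_m) (n : nat) (x : X) : 'M[R[i]]_m :=
  if n is n'.+1 then A (iter n' f x) *m cocycle f A n' x else 1%:M.

(* 0-based: [lyap mu f A k] is L_(k+1). *)
Definition lyap (R : realType) (dX : measure_display) (X : measurableType dX)
    (mu : {measure set X -> \bar R}) (f : X -> X) (m : nat)
    (A : X -> 'M[R[i]]_m) (k : nat) : \bar R :=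
  limn (fun n => (n%:R^-1)%:E *
                 \int[mu]_x (ln (singval (cocycle f A n x) k))%:E)%E.

(* L^k = L_1 + ... + L_k. *)
Definition lyapsum (R : realType) (dX : measure_display)
    (X : measurableType dX) (mu : {measure set X -> \bar R}) (f : X -> X)
    (m : nat) (A : X -> 'M[R[i]]_m) (k : nat) : \bar R :=
  (\sum_(j < k) lyap mu f A j)%E.

(* Main.v *)
(* The unitary diagonalizing J turns T into a pseudo-unitary block matrix
   (A, B; D, E) and R_theta into e^(-i pi theta) diag(z, 1), with
   z = e^(2 i pi theta).  Since T^* T + (T^* T)^-1 + 2 has the diagonal blocks
   4 A^* A and 4 E^* E and no others, and the singular values come in pairs
   s, 1/s, one gets N_d(T) = ln |det E|.  For a product of the R_theta T_j the
   corresponding determinant is, up to a factor of modulus one, a polynomial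
   q(z).  For |z| <= 1 the factors diag(z, 1) T_j do not increase the form
   |v_+|^2 - |v_-|^2, so q has no zero in the closed unit disc, and Jensen's
   formula gives ln |q(0)| = sum_j N_d(T_j) as the average of ln |q|: this is
   the first formula of (2).

   N_d differs from ln ||Lambda^d|| by at most d ln 2 on HSp(2d).  Applied to
   the powers of the product, the first formula of (2) therefore gives the
   second one through Gelfand's formula and dominated convergence.  Likewise
   L^d is the limit of the averages of N_d of the cocycle, and (1) follows by
   Tonelli's theorem and dominated convergence.  The limits exist by Fekete's
   lemma, used with the Hilbert-Schmidt norm of Lambda^k, which is
   submultiplicative by the Cauchy-Binet formula. *)
Require Import Defs.
From mathcomp Require Import all_boot all_order all_algebra all_fingroup.
From mathcomp Require Import all_classical all_reals all_analysis.
From mathcomp Require Import complex ring lra zify measurable_realfun.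

Set Implicit Arguments.
Unset Strict Implicit.
Unset Printing Implicit Defensive.
Import Order.TTheory GRing.Theory Num.Theory.
Import numFieldNormedType.Exports.
Local Open Scope classical_set_scope.
Local Open Scope sesquilinear_scope.
Local Open Scope ring_scope.

(** * Exterior powers *)

(** The exponents are [limn] of averaged logarithms of single singular values, and [limn] carries
    information only about convergent sequences. Convergence is therefore proved for every partial
    product [sigprod2 k] with [k <= d], and each exponent is recovered from a difference of two
    limits. Sorted singular values are awkward both for measurability and for products. The
    estimates go instead through squared Hilbert-Schmidt norms of exterior powers, which are
    polynomial in the real and imaginary parts of the entries and see [T] only through [T^* T]. The
    unitary rotations thus never enter a bound, and the dominating functions do not depend on
    [theta]. The formula for finite products is exact: after division by the number of factors, the
    averages for powers, or for cocycles integrated over the invariant measure, do not depend on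
    [n]. Only a pointwise limit is needed, without any rate. Jensen's formula is used only for
    polynomials without zeros in the closed disc, where it reduces to the vanishing mean of
    [ln |1 - b z|] for [|b| < 1]. *)

Section CauchyBinet.
Variables (S : comNzRingType) (k m : nat).
Implicit Types (f : {ffun 'I_k -> 'I_m}) (t : k.-tuple 'I_m).

(** Row multilinearity: distributing the product of the inner sums labels the terms by maps [f], and
    what remains of the sum over permutations is the determinant of the rows selected by [f]. *)
Lemma det_mulmx_rowsub (A : 'M[S]_(k, m)) (B : 'M[S]_(m, k)) :
  \det (A *m B) = \sum_(f : {ffun 'I_k -> 'I_m}) (\prod_i A i (f i)) *
    \det (rowsub f B).
Proof.
rewrite /determinant.
under eq_bigr => s _.
  under eq_bigr => i _ do rewrite mxE.
  rewrite bigA_distr_bigA /= big_distrr /=.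
  over.
rewrite exchange_big /=; apply: eq_bigr => f _.
rewrite big_distrr /=; apply: eq_bigr => s _.
rewrite big_split /= mulrCA; congr (_ * (_ * _)).
by apply: eq_bigr => i _; rewrite mxE.
Qed.

Lemma det_rowsub_noninj f (B : 'M[S]_(m, k)) :
  ~~ injectiveb f -> \det (rowsub f B) = 0.
Proof.
move=> /injectivePn[i [j ij fij]].
by apply: (determinant_alternate ij) => l; rewrite !mxE fij.
Qed.

Lemma det_rowsub_perm (g : 'I_k -> 'I_m) (s : 'S_k) (B : 'M[S]_(m, k)) :
  \det (rowsub (g \o s) B) = (-1) ^+ s * \det (rowsub g B).
Proof.
have -> : rowsub (g \o s) B = row_perm s (rowsub g B).
  by apply/matrixP => i j; rewrite !mxE.
by rewrite row_permE det_mulmx det_perm.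
Qed.

Lemma ltn_tuplesP t :
  reflect (sorted ltn [seq val i | i <- t]) (t \in ltn_tuples k m).
Proof. by rewrite inE; exact: idP. Qed.

Lemma ltn_tuples_inj t : t \in ltn_tuples k m -> injective (tnth t).
Proof.
move=> /ltn_tuplesP st.
have /(map_uniq (f := val)) /tuple_uniqP// : uniq [seq val i | i <- t].
by apply: (sorted_uniq ltn_trans ltnn).
Qed.

Lemma ltn_tuples_perm t t' : t \in ltn_tuples k m -> t' \in ltn_tuples k m ->
  perm_eq t t' -> t = t'.
Proof.
move=> /ltn_tuplesP st /ltn_tuplesP st' tt'; apply/val_inj/(inj_map val_inj).
apply: (irr_sorted_eq ltn_trans ltnn) => //.
by move=> x; apply/perm_mem/perm_map.
Qed.

Lemma widen_ltn_tuples (km : (k <= m)%N) :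
  [tuple widen_ord km i | i < k] \in ltn_tuples k m.
Proof.
apply/ltn_tuplesP; rewrite -map_comp.
have -> : [seq (val \o widen_ord km) i | i <- enum 'I_k] = iota 0 k.
  by rewrite -val_enum_ord; exact: eq_map.
exact: iota_ltn_sorted.
Qed.

(** On injective maps, the fibres group the [f] by their set of values, one fibre per minor of the
    Cauchy-Binet sum. *)
Definition ltn_sort (f : {ffun 'I_k -> 'I_m}) : k.-tuple 'I_m :=
  [tuple of sort (fun i j : 'I_m => (i <= j)%N) [tuple f i | i < k]].

Lemma ltn_sort_tuples f : injectiveb f -> ltn_sort f \in ltn_tuples k m.
Proof.
move=> /injectiveP finj; apply/ltn_tuplesP.
rewrite ltn_sorted_uniq_leq; apply/andP; split.
  rewrite (map_inj_uniq val_inj) sort_uniq.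
  by apply/tuple_uniqP => i j; rewrite !tnth_mktuple => /finj.
rewrite sorted_map; apply: sort_sorted => i j; exact: leq_total.
Qed.

(** An injective map is in a unique way a permutation followed by an increasing tuple; [h] is the
    resulting bijection from permutations onto a fibre of [ltn_sort]. *)
Lemma sum_inj_ltn (g : {ffun 'I_k -> 'I_m} -> S) :
  \sum_(f : {ffun 'I_k -> 'I_m} | injectiveb f) g f =
  \sum_(t in ltn_tuples k m) \sum_(s : 'S_k) g [ffun i => tnth t (s i)].
Proof.
rewrite (partition_big ltn_sort [in ltn_tuples k m]) => [|f]; last first.
  exact: ltn_sort_tuples.
apply: eq_bigr => t tin.
pose h (s : 'S_k) := [ffun i => tnth t (s i)].
have tinj := ltn_tuples_inj tin.
have hinj : injective h.
  by move=> s s' /ffunP hs; apply/permP => i; have := hs i;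
    rewrite !ffunE => /tinj.
(* On the fibre a permutation is always found, so the default [1%g] is never reached there. *)
pose h' f := odflt 1%g [pick s | h s == f].
rewrite (reindex h) /=; last first.
  exists h' => [s _|f].
    rewrite /h'; case: pickP => [s' /eqP /hinj//|/(_ s)].
    by rewrite eqxx.
  rewrite inE => /andP[_ /eqP ft]; rewrite /h'.
  case: pickP => [s /eqP//|none]; exfalso.
  have : perm_eq [tuple f i | i < k] t by rewrite -ft perm_sym perm_sort.
  move=> /tuple_permP[s es]; have /negP[] := none s; apply/eqP/ffunP => i.
  rewrite ffunE.
  have -> : f i = tnth [tuple f i | i < k] i by rewrite tnth_mktuple.
  have -> : [tuple f i | i < k] = [tuple tnth t (s i) | i < k].
    exact: val_inj.
  by rewrite tnth_mktuple.
apply: eq_bigl => s; apply/andP; split.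
  by apply/injectiveP => i j; rewrite !ffunE => /tinj /perm_inj.
apply/eqP/ltn_tuples_perm => //.
  apply: ltn_sort_tuples.
  by apply/injectiveP => i j; rewrite !ffunE => /tinj /perm_inj.
rewrite perm_sort; apply/tuple_permP; exists s.
congr val; apply: eq_from_tnth => i; by rewrite !tnth_mktuple ffunE.
Qed.

(** Non-injective maps give minors with a repeated row. On each fibre of [ltn_sort], the signs from
    reordering the rows turn the sum over permutations into the determinant of the chosen columns of
    [A]. *)
Theorem Cauchy_Binet (A : 'M[S]_(k, m)) (B : 'M[S]_(m, k)) :
  \det (A *m B) = \sum_(t in ltn_tuples k m)
    \det (colsub (tnth t) A) * \det (rowsub (tnth t) B).
Proof.
rewrite det_mulmx_rowsub (bigID (fun f => injectiveb f)) /=.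
rewrite [X in _ + X]big1 ?addr0; last first.
  by move=> f fninj; rewrite det_rowsub_noninj ?mulr0.
rewrite sum_inj_ltn; apply: eq_bigr => t _.
rewrite [\det (colsub _ _)]/determinant big_distrl /=; apply: eq_bigr => s _.
have -> : rowsub [ffun i => tnth t (s i)] B = rowsub (tnth t \o s) B.
  by apply/matrixP => i j; rewrite !mxE ffunE.
rewrite det_rowsub_perm mulrCA mulrA; congr (_ * _ * _).
by apply: eq_bigr => i _; rewrite mxE ffunE.
Qed.

End CauchyBinet.

Section ExteriorPower.
Variables (R : realType) (m k : nat).
Implicit Types T : 'M[R[i]]_m.

Lemma extpowM T T' : extpow k (T *m T') = extpow k T *m extpow k T'.
Proof.
apply/matrixP => I J; rewrite !mxE.
have -> : mxsub (tnth (enum_val I)) (tnth (enum_val J)) (T *m T') =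
    rowsub (tnth (enum_val I)) T *m colsub (tnth (enum_val J)) T'.
  by apply/matrixP => i j; rewrite !mxE; apply: eq_bigr => l _; rewrite !mxE.
rewrite Cauchy_Binet (reindex_onto enum_val (enum_rank_in (enum_valP I))) /=.
  apply: eq_big => [K|K _]; first by rewrite enum_valP enum_valK_in eqxx.
  rewrite /extpow !mxE; congr (_ * _); congr (\det _);
  by apply/matrixP => i j; rewrite !mxE.
by move=> t tin; rewrite enum_rankK_in.
Qed.

Lemma extpow_diag (D : 'rV[R[i]]_m) :
  extpow k (diag_mx D) =
  diag_mx (\row_I \prod_i D 0 (tnth (enum_val I) i)).
Proof.
apply/matrixP => I J; rewrite !mxE; have [->|IJ] := eqVneq I J.
  transitivity (\det (diag_mx (\row_i D 0 (tnth (enum_val J) i)))).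
    congr (\det _); apply/matrixP => i j; rewrite !mxE.
    by rewrite (inj_eq (ltn_tuples_inj (enum_valP J))).
  by rewrite mulr1n det_diag; apply: eq_bigr => i _; rewrite mxE.
rewrite mulr0n.
(* Of two distinct increasing tuples of the same length, the first has an index missing from the
   second; the corresponding row of the minor vanishes. *)
have [i iJ] : exists i, tnth (enum_val I) i \notin enum_val J.
  apply/existsP; rewrite -negb_forall; apply: contra IJ => /forallP IJ.
  apply/eqP/enum_val_inj/ltn_tuples_perm; rewrite ?enum_valP//.
  have uniqt (K : 'I_#|ltn_tuples k m|) : uniq (enum_val K : k.-tuple 'I_m).
    exact/tuple_uniqP/ltn_tuples_inj/enum_valP.
  apply: uniq_perm => //.
  have IJs : {subset (enum_val I : k.-tuple 'I_m) <=
    (enum_val J : k.-tuple 'I_m)}.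
    by move=> x /tnthP[i ->]; exact: IJ.
  by have [] := uniq_min_size (uniqt I) IJs; rewrite !size_tuple.
rewrite (expand_det_row _ i) big1// => j _.
rewrite !mxE; case: eqP => [eq|_]; last by rewrite mulr0n mul0r.
by move: iJ; rewrite eq mem_tnth.
Qed.

Lemma extpow1 : extpow k (1%:M : 'M[R[i]]_m) = 1%:M.
Proof.
rewrite -diag_const_mx extpow_diag; apply/matrixP => I J; rewrite !mxE.
by rewrite big1 // => i _; rewrite mxE.
Qed.

Lemma extpow_adj T : extpow k (T ^t*) = (extpow k T) ^t*.
Proof.
apply/matrixP => I J; rewrite !mxE -det_map_mx -det_tr; congr (\det _).
by apply/matrixP => i j; rewrite !mxE.
Qed.

End ExteriorPower.

(** * Hilbert-Schmidt norms of exterior powers *)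

Section Frobenius.
Variable R : realType.
Implicit Types m n p : nat.

(* A constant of our own, since [/=] unfolds [ComplexField.Normc.normc] to a
   square root. *)
Definition normc (z : R[i]) : R := ComplexField.Normc.normc z.

Lemma normcE (z : R[i]) : (normc z)%:C%C = `|z|. Proof. by []. Qed.

Lemma normc_ge0 z : 0 <= normc z.
Proof. by rewrite -lecR normcE normr_ge0. Qed.

Lemma normc_eq0 z : (normc z == 0) = (z == 0).
Proof. by rewrite -(inj_eq (@complexI R)) normcE normr_eq0. Qed.

Lemma normcM z w : normc (z * w) = normc z * normc w.
Proof. by apply: complexI; rewrite rmorphM /= !normcE normrM. Qed.

Lemma sqr_normcE (z : R[i]) : (normc z ^+ 2)%:C%C = z * z^*.
Proof. by rewrite rmorphXn /= normcE normCK. Qed.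

(** Kept squared: it is then the trace of a Gram matrix, and no square root interferes with
    submultiplicativity or measurability. *)
Definition frob2 m n (M : 'M[R[i]]_(m, n)) : R :=
  \sum_i \sum_j normc (M i j) ^+ 2.

Lemma frob2_ge0 m n (M : 'M[R[i]]_(m, n)) : 0 <= frob2 M.
Proof. by apply: sumr_ge0 => i _; apply: sumr_ge0 => j _; apply: sqr_ge0. Qed.

Lemma frob2E m n (M : 'M[R[i]]_(m, n)) : (frob2 M)%:C%C = \tr (M ^t* *m M).
Proof.
rewrite /frob2 /mxtrace exchange_big /= rmorph_sum /=; apply: eq_bigr => j _.
rewrite rmorph_sum mxE /=; apply: eq_bigr => i _.
by rewrite sqr_normcE !mxE mulrC.
Qed.

(** The nonnegative sum of the [(y * a i - z * b i) ^+ 2] equals [y * (x * y - z ^+ 2)]. Dividing by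
    [y] leaves the case [y = 0], where all [b i] vanish. *)
Lemma CauchySchwarz_sum (I : finType) (a b : I -> R) :
  (forall i, 0 <= a i) -> (forall i, 0 <= b i) ->
  (\sum_i a i * b i) ^+ 2 <= (\sum_i a i ^+ 2) * (\sum_i b i ^+ 2).
Proof.
move=> a0 b0; set x := \sum_i a i ^+ 2; set y := \sum_i b i ^+ 2.
set z := \sum_i _.
have y0 : 0 <= y by apply: sumr_ge0 => i _; apply: sqr_ge0.
have : 0 <= \sum_i (y * a i - z * b i) ^+ 2.
  by apply: sumr_ge0 => i _; apply: sqr_ge0.
have -> : \sum_i (y * a i - z * b i) ^+ 2 = y * (x * y - z ^+ 2).
  transitivity (\sum_i (y ^+ 2 * a i ^+ 2 + z ^+ 2 * b i ^+ 2
      - (2 * y * z) * (a i * b i))).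
    by apply: eq_bigr => i _; ring.
  rewrite sumrB big_split /= -!mulr_sumr -/x -/y -/z; ring.
have [y_gt0|y_le0] := ltrP 0 y; first by rewrite pmulr_rge0// subr_ge0.
have yE : y = 0 by apply/le_anti; rewrite y_le0.
suff -> : z = 0 by rewrite yE expr0n mulr0.
rewrite /z big1// => i _; apply/eqP.
have /eqP : b i ^+ 2 = 0.
  have := yE; rewrite /y => /eqP; rewrite psumr_eq0.
    by move=> /allP /(_ i); rewrite mem_index_enum => /(_ isT) /eqP.
  by move=> j _; apply: sqr_ge0.
by rewrite sqrf_eq0 => /eqP ->; rewrite mulr0.
Qed.

Lemma normc_sum (I : finType) (F : I -> R[i]) :
  normc (\sum_i F i) <= \sum_i normc (F i).
Proof.
rewrite -lecR normcE rmorph_sum /=; exact: ler_norm_sum.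
Qed.

Lemma frob2M m n p (M : 'M[R[i]]_(m, n)) (M' : 'M[R[i]]_(n, p)) :
  frob2 (M *m M') <= frob2 M * frob2 M'.
Proof.
rewrite /frob2 mulr_suml; apply: ler_sum => i _.
rewrite [X in _ <= _ * X]exchange_big /= mulr_sumr; apply: ler_sum => j _.
rewrite mxE; apply: le_trans (CauchySchwarz_sum _ _).
- rewrite lerXn2r ?nnegrE ?normc_ge0//.
    by apply: sumr_ge0 => l _; rewrite mulr_ge0// normc_ge0.
  by apply: le_trans (normc_sum _) _; apply: ler_sum => l _; rewrite normcM.
- by move=> l; exact: normc_ge0.
- by move=> l; exact: normc_ge0.
Qed.

Definition extfrob2 m k (T : 'M[R[i]]_m) := frob2 (extpow k T).

Lemma extfrob2M m k (T T' : 'M[R[i]]_m) :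
  extfrob2 k (T *m T') <= extfrob2 k T * extfrob2 k T'.
Proof. by rewrite /extfrob2 extpowM frob2M. Qed.

Lemma extfrob2E m k (T : 'M[R[i]]_m) :
  (extfrob2 k T)%:C%C = \tr (extpow k (T ^t* *m T)).
Proof. by rewrite frob2E extpowM extpow_adj. Qed.

(** Only the Gram matrix matters, and an isometry on the left does not change it. This removes the
    rotations from all later bounds. *)
Lemma extfrob2_isom m k (U T : 'M[R[i]]_m) : U ^t* *m U = 1%:M ->
  extfrob2 k (U *m T) = extfrob2 k T.
Proof.
move=> UU; apply: complexI; rewrite !extfrob2E trmx_mul map_mxM /=.
by rewrite mulmxA -(mulmxA (T ^t*)) UU mulmx1.
Qed.

(** By cyclicity of the trace, the value is the [k]-th elementary symmetric polynomial in the
    eigenvalues of [T^* T]. *)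
Lemma extfrob2_diag m k (T P : 'M[R[i]]_m) (D : 'rV[R]_m) :
  P \is unitarymx ->
  T ^t* *m T = P ^t* *m diag_mx (map_mx (real_complex R) D) *m P ->
  extfrob2 k T = \sum_(t in ltn_tuples k m) \prod_i D 0 (tnth t i).
Proof.
move=> Pu TE; apply: complexI; rewrite extfrob2E TE extpowM mxtrace_mulC.
rewrite -extpowM mulmxA (unitarymxP Pu) mul1mx extpow_diag mxtrace_diag.
rewrite rmorph_sum /= [RHS]big_enum_val /=.
apply: eq_bigr => I _.
by rewrite mxE rmorph_prod; apply: eq_bigr => i _; rewrite mxE.
Qed.

End Frobenius.

(** * Singular values *)

Section SingularValues.
Variables (R : realType) (m : nat).
Implicit Types T : 'M[R[i]]_m.

Lemma adjM n p q (A : 'M[R[i]]_(n, p)) (B : 'M[R[i]]_(p, q)) :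
  (A *m B) ^t* = B ^t* *m A ^t*.
Proof. by rewrite trmx_mul map_mxM. Qed.

Lemma adjK n p (A : 'M[R[i]]_(n, p)) : (A ^t*) ^t* = A.
Proof. exact: trmxCK. Qed.

Lemma gram_normal T : T ^t* *m T \is normalmx.
Proof. by apply/normalmxP; rewrite adjM adjK. Qed.

Lemma gram_diag_ge0 n p (A : 'M[R[i]]_(n, p)) i : 0 <= (A ^t* *m A) i i.
Proof.
rewrite mxE; apply: sumr_ge0 => j _; rewrite !mxE mulrC; exact: mul_conjC_ge0.
Qed.

(** In the eigenbasis given by [Q], the eigenvalue is a diagonal entry of the Gram matrix of
    [T *m Q ^t*]. *)
Lemma spectral_gram_ge0 T i : 0 <= spectral_diag (T ^t* *m T) 0 i.
Proof.
set H := T ^t* *m T; set Q := spectralmx H.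
have Qu : Q \is unitarymx := spectral_unitarymx H.
have HE : H = invmx Q *m diag_mx (spectral_diag H) *m Q.
  exact/orthomx_spectralP/gram_normal.
have -> : spectral_diag H 0 i = ((T *m Q ^t*) ^t* *m (T *m Q ^t*)) i i.
  rewrite adjM adjK mulmxA -(mulmxA Q) -/H {2}HE invmx_unitary//.
  rewrite !mulmxA (unitarymxP Qu) mul1mx mulmxtVK//.
  by rewrite mxE eqxx mulr1n.
exact: gram_diag_ge0.
Qed.

Lemma size_singvals T : size (singvals T) = m.
Proof. by rewrite size_sort size_map size_enum_ord. Qed.

Lemma singval_ge0 T i : 0 <= singval T i.
Proof.
have [im|im] := ltnP i m; last by rewrite /singval nth_default// size_singvals.
have : singval T i \in singvals T by rewrite mem_nth// size_singvals.
by rewrite mem_sort => /mapP[j _ ->]; exact: sqrtr_ge0.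
Qed.

Lemma singval_le T i j : (i <= j)%N -> singval T j <= singval T i.
Proof.
move=> ij; have [jm|jm] := ltnP j m; last first.
  by rewrite {1}/singval nth_default ?size_singvals// singval_ge0.
have st : sorted >=%R (singvals T)
  by apply: sort_sorted => x y; exact: le_total.
apply: (sorted_leq_nth _ _ 0 st) => //.
- by move=> y x z /= yx zy; exact: le_trans zy yx.
- exact: lexx.
- by rewrite inE size_singvals (leq_ltn_trans ij).
- by rewrite inE size_singvals.
Qed.

(** The spectral theorem lists the eigenvalues in no order; permuting the rows of its unitary by the
    sorting permutation brings them into the order of [singvals]. *)
Lemma gram_spectral_sorted T : exists2 P : 'M[R[i]]_m, P \is unitarymx &
  T ^t* *m T =
    P ^t* *m diag_mx (map_mx (real_complex R) (\row_i singval T i ^+ 2)) *m P.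
Proof.
set H := T ^t* *m T; set Q := spectralmx H.
have Qu : Q \is unitarymx := spectral_unitarymx H.
have HE : H = invmx Q *m diag_mx (spectral_diag H) *m Q.
  exact/orthomx_spectralP/gram_normal.
pose l := [tuple Num.sqrt (complex.Re (spectral_diag H 0 i)) | i < m].
have [s sE] : exists s : 'S_m, forall i : 'I_m, singval T i = tnth l (s i).
  have szs : size (singvals T) == m by rewrite size_singvals.
  have /tuple_permP[s sE] : perm_eq (Tuple szs) l by rewrite perm_sort.
  exists s => i; transitivity (tnth (Tuple szs) i).
    by rewrite (tnth_nth 0).
  suff -> : Tuple szs = [tuple tnth l (s i) | i < m] by rewrite tnth_mktuple.
  exact: val_inj.
exists (row_perm s Q).
  rewrite row_permE; refine (mul_unitarymx _ Qu); apply/unitarymxP.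
  by rewrite tr_perm_mx map_perm_mx -perm_mxM mulgV perm_mx1.
rewrite HE invmx_unitary//; apply/matrixP => a b.
have mulE (D : 'rV[R[i]]_m) (M : 'M[R[i]]_m) :
    (M ^t* *m diag_mx D *m M) a b = \sum_i (M i a)^* * D 0 i * M i b.
  by rewrite mul_mx_diag !mxE; apply: eq_bigr => i _; rewrite !mxE.
rewrite !mulE (reindex_perm s); apply: eq_bigr => i _; rewrite !mxE.
congr (_ * _ * _); rewrite sE tnth_mktuple sqr_sqrtr.
  by rewrite RRe_real// ger0_real// spectral_gram_ge0.
by rewrite -lecR RRe_real ?ger0_real// spectral_gram_ge0.
Qed.

Lemma ltn_tuples_ge k (t : k.-tuple 'I_m) (i : 'I_k) :
  t \in ltn_tuples k m -> (i <= tnth t i)%N.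
Proof.
move=> /ltn_tuplesP st; have iE j : (j < k)%N -> (j <= nth 0 (map val t) j)%N.
  elim: j => // j IH jk; apply: leq_ltn_trans (IH (ltnW jk)) _.
  by apply: (sortedP 0%N st); rewrite size_map size_tuple.
have := iE i (ltn_ord i).
have x0 : 'I_m := tnth t i.
by rewrite (nth_map x0) ?size_tuple// (tnth_nth x0).
Qed.

(** Among the [k]-fold products of eigenvalues, the one over the first [k] indices is the largest,
    because the [i]-th entry of an increasing tuple is at least [i]. The sum lies between this term
    and the number of terms times it. *)
Lemma extfrob2_bounds k (e : nat -> R) (P T : 'M[R[i]]_m) : (k <= m)%N ->
  (forall i, 0 <= e i) -> {homo e : i j / (i <= j)%N >-> j <= i} ->
  P \is unitarymx ->
  T ^t* *m T = P ^t* *m diag_mx (map_mx (real_complex R) (\row_i e i)) *m P ->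
  \prod_(i < k) e i <= extfrob2 k T <= #|ltn_tuples k m|%:R * \prod_(i < k) e i.
Proof.
move=> km e0 ed Pu TE; rewrite (extfrob2_diag k Pu TE); apply/andP; split.
  rewrite (bigD1 _ (widen_ltn_tuples km)) /=
    [X in _ <= X + _](eq_bigr (fun i : 'I_k => e i)); last first.
    by move=> i _; rewrite mxE tnth_mktuple.
  rewrite lerDl; apply: sumr_ge0 => t _; apply: prodr_ge0 => i _.
  by rewrite mxE.
rewrite mulr_natl -sumr_const; apply: ler_sum => t tin.
apply: ler_prod => i _; rewrite mxE e0 /=; apply: ed.
exact: ltn_tuples_ge.
Qed.

(* The squared operator norm of [extpow k T]; it differs from [extfrob2 k T] by
   at most the factor [#|ltn_tuples k m|]. *)
Definition sigprod2 k T : R := \prod_(i < k) singval T i ^+ 2.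

Lemma extfrob2_sigprod2 k T : (k <= m)%N ->
  sigprod2 k T <= extfrob2 k T <= #|ltn_tuples k m|%:R * sigprod2 k T.
Proof.
move=> km; have [P Pu TE] := gram_spectral_sorted T.
apply: (extfrob2_bounds (e := fun i => singval T i ^+ 2) km _ _ Pu TE).
  by move=> i; rewrite exprn_ge0// singval_ge0.
move=> i j ij; rewrite lerXn2r// ?nnegrE ?singval_ge0//; exact: singval_le.
Qed.

Lemma gram_pow_spectral T (P : 'M[R[i]]_m) (D : 'rV[R]_m) n : P \is unitarymx ->
  T ^t* *m T = P ^t* *m diag_mx (map_mx (real_complex R) D) *m P ->
  (T ^t* *m T) ^+ n =
    P ^t* *m diag_mx (map_mx (real_complex R) (\row_i D 0 i ^+ n)) *m P.
Proof.
move=> Pu TE; elim: n => [|n IH].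
  have -> : diag_mx (map_mx (real_complex R) (\row_i D 0 i ^+ 0)) = 1%:M.
    by rewrite -diag_const_mx; congr diag_mx; apply/rowP => i; rewrite !mxE.
  rewrite mulmx1; apply/esym/mulmx1C; exact/unitarymxP.
rewrite exprS -mulmxE IH {1}TE.
rewrite -!mulmxA (mulmxA P (P ^t*)) (unitarymxP Pu) mul1mx.
rewrite (mulmxA (diag_mx _)) mulmx_diag; congr (_ *m (diag_mx _ *m _)).
by apply/rowP => i; rewrite !mxE -rmorphM exprS.
Qed.

(** A power of [T^* T] is Hermitian, so its own Gram matrix is the power of twice the exponent. The
    error factor does not depend on [n] and disappears when a root of order [n + n] is taken. *)
Lemma extfrob2_gram_pow k T n : (k <= m)%N ->
  sigprod2 k T ^+ (n + n) <= extfrob2 k ((T ^t* *m T) ^+ n)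
    <= #|ltn_tuples k m|%:R * sigprod2 k T ^+ (n + n).
Proof.
move=> km; have [P Pu TE] := gram_spectral_sorted T.
pose e i := (singval T i ^+ 2) ^+ (n + n).
have -> : sigprod2 k T ^+ (n + n) = \prod_(i < k) e i by rewrite -prodrXl.
apply: (extfrob2_bounds (e := e) km _ _ Pu).
- by move=> i; rewrite !exprn_ge0// singval_ge0.
- move=> i j ij; rewrite !lerXn2r// ?nnegrE ?exprn_ge0 ?singval_ge0//.
  exact: singval_le.
have /(congr1 (fun M => M ^t*)) := gram_pow_spectral n Pu TE.
have Ha : ((T ^t* *m T) ^+ n) ^t* = (T ^t* *m T) ^+ n.
  elim: n {e} => [|n IH]; first by rewrite trmx1 map_mx1.
  by rewrite exprS -mulmxE adjM IH adjM adjK mulmxE -exprSr exprS.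
rewrite Ha mulmxE -exprD => _; rewrite (gram_pow_spectral (n + n) Pu TE).
by congr (_ *m diag_mx _ *m _); apply/rowP => i; rewrite !mxE.
Qed.

(** The squares of the singular values sum to the squared Hilbert-Schmidt norm, which has [m ^ 2]
    terms. *)
Lemma singval0_le T (b : R) : 0 <= b -> (0 < m)%N ->
  (forall i j, normc (T i j) <= b) -> singval T 0 <= m%:R * b.
Proof.
move=> b0 m0 Tb; have [P Pu TE] := gram_spectral_sorted T.
have trE : \sum_(i < m) singval T i ^+ 2 = frob2 T.
  apply: complexI; rewrite frob2E TE mxtrace_mulC mulmxA (unitarymxP Pu).
  rewrite mul1mx mxtrace_diag rmorph_sum; apply: eq_bigr => i _.
  by rewrite !mxE.
have : singval T 0 ^+ 2 <= (m%:R * b) ^+ 2.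
  apply: (@le_trans _ _ (frob2 T)).
    rewrite -trE (bigD1 (Ordinal m0)) //= lerDl.
    by apply: sumr_ge0 => i _; rewrite sqr_ge0.
  rewrite exprMn -natrX -mulnn natrM -mulrA mulr_natl.
  rewrite -[X in _ *+ X]card_ord -sumr_const; apply: ler_sum => i _.
  rewrite mulr_natl -[X in _ *+ X]card_ord -sumr_const; apply: ler_sum => j _.
  by rewrite lerXn2r// nnegrE ?normc_ge0.
by rewrite ler_pXn2r// ?nnegrE ?singval_ge0// mulr_ge0.
Qed.

Lemma l2norm_ge0 (v : 'cV[R[i]]_m) : 0 <= l2norm v.
Proof. exact: sqrtr_ge0. Qed.

Lemma frob2_l2norm (v : 'cV[R[i]]_m) : frob2 v = l2norm v ^+ 2.
Proof.
rewrite /l2norm sqr_sqrtr.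
  by apply: eq_bigr => i _; rewrite big_ord1.
by apply: sumr_ge0 => i _; exact: sqr_ge0.
Qed.

Lemma normc_le_opnorm T i j : normc (T i j) <= opnorm T.
Proof.
(* [sup] dominates the members of a set only if the set is bounded; the Hilbert-Schmidt norm is a
   bound. The entry is then read off the image of the [j]-th basis vector. *)
have ub : has_ubound
    [set l2norm (T *m v) | v in [set v : 'cV[R[i]]_m | l2norm v <= 1]].
  exists (Num.sqrt (frob2 T)) => _ [v /= v1 <-].
  rewrite -(ler_pXn2r (ltn0Sn 1)) ?nnegrE ?sqrtr_ge0 ?l2norm_ge0//.
  rewrite -frob2_l2norm sqr_sqrtr ?frob2_ge0// (le_trans (frob2M _ _))//.
  rewrite ler_piMr ?frob2_ge0// frob2_l2norm.
  by rewrite expr_le1// l2norm_ge0.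
apply: (@le_trans _ _ (l2norm (T *m delta_mx j 0))); last first.
  apply: ub_le_sup => //; exists (delta_mx j 0) => //=.
  rewrite -(ler_pXn2r (ltn0Sn 1)) ?nnegrE ?l2norm_ge0// -frob2_l2norm expr1n.
  rewrite /frob2 (bigD1 j)//= big_ord1 mxE !eqxx big1.
    by rewrite addr0 [normc _]ComplexField.Normc.normc1 expr1n.
  move=> l lj; rewrite big_ord1 mxE (negPf lj) /=.
  by rewrite [X in X ^+ 2]ComplexField.Normc.normc0 expr0n.
rewrite -(ler_pXn2r (ltn0Sn 1)) ?nnegrE ?l2norm_ge0 ?normc_ge0// -frob2_l2norm.
rewrite /frob2 (bigD1 i)//= big_ord1 -colE mxE lerDl.
by apply: sumr_ge0 => l _; apply: sumr_ge0 => o _; exact: sqr_ge0.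
Qed.

(** Not sharp: the factor [m] only adds a constant to the logarithm, which is harmless for
    integrability. *)
Lemma singval0_le_opnorm T : (0 < m)%N -> singval T 0 <= m%:R * opnorm T.
Proof.
move=> m0; apply: singval0_le => // [|i j]; last exact: normc_le_opnorm.
exact: le_trans (normc_ge0 _) (normc_le_opnorm T (Ordinal m0) (Ordinal m0)).
Qed.

End SingularValues.

(** * Cayley transform *)

Section ScalarBlocks.
Variables (R : realType) (d : nat).
Local Notation C := R[i].
Local Notation M2 := 'M[C]_(d + d).

(** Such matrices multiply like 2 x 2 matrices of scalars, so identities between [symplJ], the
    rotations and the Cayley matrices become [ring] goals. *)
Definition sblock (a b c e : C) : M2 := block_mx a%:M b%:M c%:M e%:M.

Lemma sblockM a b c e a' b' c' e' :
  sblock a b c e *m sblock a' b' c' e' =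
  sblock (a * a' + b * c') (a * b' + b * e') (c * a' + e * c')
    (c * b' + e * e').
Proof. by rewrite mulmx_block -!scalar_mxM -!raddfD. Qed.

Lemma sblock_adj a b c e : (sblock a b c e) ^t* = sblock a^* c^* b^* e^*.
Proof. by rewrite tr_block_mx map_block_mx !tr_scalar_mx !map_scalar_mx. Qed.

Lemma sblock1 : sblock 1 0 0 1 = 1%:M.
Proof. by rewrite /sblock raddf0 -scalar_mx_block. Qed.

Lemma scale_sblock x a b c e :
  x *: sblock a b c e = sblock (x * a) (x * b) (x * c) (x * e).
Proof. by rewrite scale_block_mx !scale_scalar_mx. Qed.

Lemma symplJE : symplJ R d = sblock 0 1 (-1) 0.
Proof. by rewrite /symplJ /sblock raddf0 raddfN. Qed.

Lemma symplJ_sqr : symplJ R d *m symplJ R d = - 1%:M.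
Proof.
transitivity (-1 *: 1%:M : M2); last by rewrite scaleN1r.
rewrite symplJE sblockM -sblock1 scale_sblock.
by congr sblock; ring.
Qed.

Definition rot_c (theta : R) : C := (cos (pi * theta))%:C%C.
Definition rot_s (theta : R) : C := (sin (pi * theta))%:C%C.

Lemma rotmxE theta : rotmx d theta =
  sblock (rot_c theta) (- rot_s theta) (rot_s theta) (rot_c theta).
Proof. by rewrite /rotmx /sblock raddfN. Qed.

Lemma conj_rot_c theta : (rot_c theta)^* = rot_c theta.
Proof. exact: conjc_real. Qed.

Lemma conj_rot_s theta : (rot_s theta)^* = rot_s theta.
Proof. exact: conjc_real. Qed.

Lemma rot_csE theta : rot_c theta ^+ 2 + rot_s theta ^+ 2 = 1.
Proof. by rewrite /rot_c /rot_s -!rmorphXn -rmorphD /= cos2Dsin2. Qed.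

Lemma rotmx_unitary (theta : R) : (rotmx d theta) ^t* *m rotmx d theta = 1%:M.
Proof.
rewrite rotmxE sblock_adj sblockM -sblock1 rmorphN /= conj_rot_c conj_rot_s.
by congr sblock; rewrite -?(rot_csE theta); ring.
Qed.

Lemma HSpM T T' : HSp T -> HSp T' -> HSp (T *m T' : M2).
Proof.
rewrite /HSp /= adjM => TJ T'J.
have -> : T' ^t* *m T ^t* *m symplJ R d *m (T *m T') =
    T' ^t* *m (T ^t* *m symplJ R d *m T) *m T' by rewrite !mulmxA.
by rewrite TJ.
Qed.

Lemma HSp1 : HSp (1%:M : M2).
Proof. by rewrite /HSp /= trmx1 map_mx1 mul1mx mulmx1. Qed.

Lemma HSp_rotmx (theta : R) : HSp (rotmx d theta).
Proof.
rewrite /HSp /= rotmxE symplJE sblock_adj !sblockM rmorphN /=.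
rewrite conj_rot_c conj_rot_s.
have h : rot_c theta ^+ 2 = 1 - rot_s theta ^+ 2.
  by rewrite -(rot_csE theta) addrK.
by congr sblock; ring: h.
Qed.

(** The defining relation and [J^2 = -1] make the second factor a left inverse; for square matrices
    it is a right inverse too. *)
Lemma HSp_mulKl (T : M2) : HSp T ->
  T *m (- symplJ R d *m T ^t* *m symplJ R d) = 1%:M.
Proof.
rewrite /HSp /= => TJ; apply: mulmx1C.
by rewrite -!mulmxA (mulmxA (T ^t*)) TJ mulNmx symplJ_sqr opprK.
Qed.

(** Multiplying the right-inverse identity by [J] gives [T J T^* = J]. *)
Lemma HSp_adj T : HSp T -> HSp (T ^t* : M2).
Proof.
move=> TH; have := HSp_mulKl TH.
move=> /(congr1 (fun M => M *m symplJ R d)).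
rewrite mul1mx !mulNmx mulmxN mulNmx -!mulmxA symplJ_sqr !mulmxN mulmx1 opprK.
by rewrite /HSp /= adjK !mulmxA.
Qed.

Lemma symplJ_det_neq0 : \det (symplJ R d) != 0.
Proof.
have : \det (symplJ R d *m symplJ R d) != 0.
  rewrite symplJ_sqr -scaleN1r detZ det1 mulr1.
  by rewrite expf_neq0// oppr_eq0 oner_eq0.
by rewrite det_mulmx mulf_eq0 negb_or => /andP[].
Qed.

Lemma det_adj n (A : 'M[C]_n) : \det (A ^t*) = (\det A)^*.
Proof. by rewrite det_map_mx det_tr. Qed.

Lemma HSp_det T : HSp T -> (\det (T : M2))^* * \det T = 1.
Proof.
rewrite /HSp /= => /(congr1 determinant); rewrite !det_mulmx det_adj mulrAC.
by move=> /(canRL (mulfK symplJ_det_neq0)) ->; rewrite divff// symplJ_det_neq0.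
Qed.

Local Notation im := ('i%C : C).

Lemma conj_im : im^* = - im.
Proof. by apply/eqP; rewrite eq_complex /= oppr0 !eqxx. Qed.

Lemma mul_im : im * im = -1.
Proof. by rewrite -expr2 sqr_i. Qed.

(** The two block columns span the eigenspaces of [symplJ] for [-i] and [i]. Left unnormalized, to
    avoid a square root of 2; the factor 1/2 sits in [cay]. *)
Definition cayV : M2 := sblock 1 1 (- im) im.
Definition sgnG : M2 := sblock 1 0 0 (-1).

Lemma cayVV : cayV ^t* *m cayV = 2%:R *: 1%:M.
Proof.
rewrite /cayV sblock_adj sblockM -sblock1 scale_sblock rmorphN /= !conj_im
  rmorph1.
by congr sblock; have := mul_im; move=> h; ring: h.
Qed.

(* [cayV / sqrt 2] is unitary and diagonalizes [symplJ] and all the rotations;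
   [cay] turns Hermitian-symplectic matrices into pseudo-unitary ones. *)
Definition cay (T : M2) : M2 := 2%:R^-1 *: (cayV ^t* *m T *m cayV).

Let two_neq0 : (2%:R : C) != 0. Proof. by rewrite pnatr_eq0. Qed.

Lemma cayVVr : cayV *m cayV ^t* = 2%:R *: 1%:M.
Proof.
have : (2%:R^-1 *: cayV ^t*) *m cayV = 1%:M.
  by rewrite -scalemxAl cayVV scalerA mulVf// scale1r.
move=> /mulmx1C; rewrite -scalemxAr => /(congr1 (fun M => 2%:R *: M)).
by rewrite scalerA divff// scale1r.
Qed.

Lemma cayM T T' : cay (T *m T') = cay T *m cay T'.
Proof.
rewrite /cay -scalemxAl -scalemxAr; congr (_ *: _).
rewrite -!mulmxA (mulmxA cayV) cayVVr -!scalemxAl -!scalemxAr mul1mx.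
by rewrite scalerA mulVf// scale1r.
Qed.

Lemma cay1 : cay 1%:M = 1%:M.
Proof. by rewrite /cay mulmx1 cayVV scalerA mulVf// scale1r. Qed.

Lemma cay_adj T : cay (T ^t*) = (cay T) ^t*.
Proof.
rewrite /cay linearZ /= map_mxZ /= !adjM adjK mulmxA; congr (_ *: _).
by rewrite fmorphV rmorph_nat.
Qed.

Lemma cayD T T' : cay (T + T') = cay T + cay T'.
Proof. by rewrite /cay mulmxDr mulmxDl scalerDr. Qed.

Lemma det_cay T : \det (cay T) = \det T.
Proof.
rewrite /cay detZ !det_mulmx mulrAC -det_mulmx cayVV detZ det1 mulr1 mulrA.
by rewrite -exprMn mulVf// expr1n mul1r.
Qed.

Lemma cay_symplJ : cay (symplJ R d) = - im *: sgnG.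
Proof.
rewrite /cay /cayV /sgnG symplJE sblock_adj !sblockM !scale_sblock.
rewrite rmorphN /= !conj_im rmorph1.
have h := mul_im; congr sblock; apply: (mulfI two_neq0);
  rewrite mulrA divff// mul1r.
all: ring: h.
Qed.

Lemma cay_rotmx theta : cay (rotmx d theta) =
  sblock (rot_c theta + im * rot_s theta) 0 0 (rot_c theta - im * rot_s theta).
Proof.
rewrite /cay /cayV rotmxE sblock_adj !sblockM !scale_sblock.
rewrite rmorphN /= !conj_im rmorph1.
have h := mul_im; congr sblock; apply: (mulfI two_neq0);
  rewrite mulrA divff// mul1r.
all: ring: h.
Qed.

Lemma cay_HSp T : HSp T -> (cay T) ^t* *m sgnG *m cay T = sgnG.
Proof.
rewrite /HSp /= => /(congr1 cay); rewrite !cayM cay_adj cay_symplJ.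
move: (cay T) => K; rewrite -scalemxAr -scalemxAl => /(scalerI _); apply.
by rewrite oppr_eq0; apply/eqP => /(congr1 (fun z => z * z));
  rewrite mul_im mul0r => /eqP; rewrite oppr_eq0 oner_eq0.
Qed.

Lemma sgnG_sqr : sgnG *m sgnG = 1%:M.
Proof. by rewrite /sgnG sblockM -sblock1; congr sblock; ring. Qed.

Lemma sgnG_conj (A B D E : 'M[C]_d) :
  sgnG *m block_mx A B D E *m sgnG = block_mx A (- B) (- D) E.
Proof.
have -> : sgnG = block_mx 1%:M 0 0 (- 1%:M).
  by rewrite /sgnG /sblock raddf0 raddfN.
rewrite !mulmx_block !mul1mx !mul0mx !mulNmx !mul1mx !addr0 !add0r.
by rewrite !(mulmx0, mulmxN, mulmx1, opprK, oppr0, addr0, add0r).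
Qed.

(** * Block identities for pseudo-unitary matrices *)

Section PseudoUnitary.
Variables (A B D E : 'M[C]_d).
Let K : M2 := block_mx A B D E.
Hypothesis KG : K ^t* *m sgnG *m K = sgnG.

Let KadjE : K ^t* = block_mx (A ^t*) (D ^t*) (B ^t*) (E ^t*).
Proof. by rewrite tr_block_mx map_block_mx. Qed.

Let sgnGE : sgnG = block_mx 1%:M 0 0 (- 1%:M).
Proof. by rewrite /sgnG /sblock raddf0 raddfN. Qed.

Lemma pseudo_unitary_ul : D ^t* *m D = A ^t* *m A - 1%:M.
Proof.
have := KG; rewrite KadjE sgnGE !mulmx_block => /eq_block_mx[+ _ _ _].
rewrite !(mulmx0, mulmx1, mulmxN, mulNmx, addr0, add0r) => <-.
by rewrite opprB addrCA subrr addr0.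
Qed.

Lemma pseudo_unitary_dr : B ^t* *m B = E ^t* *m E - 1%:M.
Proof.
have := KG; rewrite KadjE sgnGE !mulmx_block => /eq_block_mx[_ _ _ +].
rewrite !(mulmx0, mulmx1, mulmxN, mulNmx, addr0, add0r) => <-.
by rewrite addrCA subrr addr0.
Qed.

(** Jacobi's identity for complementary minors: the inverse of [K] is [G K^* G], with lower right
    block [E^*]. Multiplying [K] by the identity columns followed by the second block column of its
    inverse gives a block triangular matrix with diagonal blocks [A] and 1. *)
Lemma pseudo_unitary_det : \det K * (\det E)^* = \det A.
Proof.
have KK : K *m (sgnG *m K ^t* *m sgnG) = 1%:M.
  by apply: mulmx1C; rewrite -!mulmxA (mulmxA (K ^t*)) KG sgnG_sqr.
have KinvE : sgnG *m K ^t* *m sgnG =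
    block_mx (A ^t*) (- D ^t*) (- B ^t*) (E ^t*).
  by rewrite KadjE sgnG_conj.
have := KK; rewrite KinvE mulmx_block -sblock1 /sblock raddf0.
move=> /eq_block_mx[_ ur _ dr].
have : K *m block_mx 1%:M (- D ^t*) 0 (E ^t*) = block_mx A 0 D 1%:M.
  by rewrite mulmx_block ur dr !mulmx0 !mulmx1 !addr0.
move=> /(congr1 determinant).
by rewrite det_mulmx det_ublock det_lblock !det1 mul1r mulr1 det_adj.
Qed.

(** Conjugation by [sgnG] flips the sign of the off-diagonal blocks, so these cancel; the diagonal
    blocks of [K^* K] are [2 A^* A - 1] and [2 E^* E - 1] by the two preceding relations. *)
Lemma pseudo_unitary_gram :
  K ^t* *m K + sgnG *m (K ^t* *m K) *m sgnG + 2%:R *: 1%:M =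
  4%:R *: block_mx (A ^t* *m A) 0 0 (E ^t* *m E).
Proof.
have half (X Y : 'M[C]_d) : Y = X - 1%:M ->
  X + Y + (X + Y) + 2%:R *: 1%:M = 4%:R *: X.
  by move=> ->; apply/matrixP => i j; rewrite !mxE; ring.
rewrite KadjE mulmx_block sgnG_conj.
have -> : 2%:R *: 1%:M = block_mx (2%:R *: 1%:M) 0 0 (2%:R *: 1%:M) :> M2.
  by rewrite -sblock1 /sblock raddf0 scale_block_mx scaler0.
rewrite !add_block_mx scale_block_mx scaler0 !addrN !addr0.
rewrite (half _ _ pseudo_unitary_ul) [B ^t* *m B + _]addrC.
by rewrite (half _ _ pseudo_unitary_dr).
Qed.

End PseudoUnitary.

End ScalarBlocks.

(** * Singular values of Hermitian-symplectic matrices *)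

(** Inversion reverses the order, so the reversed list of inverse squares is decreasing as well; two
    decreasing lists that are permutations of each other agree entrywise. *)
Lemma sorted_perm_inv (R : realType) (s : seq R) :
  sorted >=%R s -> all (> 0) s ->
  perm_eq [seq x ^- 2 | x <- s] [seq x ^+ 2 | x <- s] ->
  forall i, (i < size s)%N -> s`_i = (s`_(size s - i.+1)%N)^-1.
Proof.
move=> st /allP s0 ps0 i si; pose s1 := rev [seq x ^- 2 | x <- s].
have ps : perm_eq s1 [seq x ^+ 2 | x <- s] by rewrite perm_rev.
have sq x y : x \in s -> y \in s -> y <= x -> y ^+ 2 <= x ^+ 2.
  move=> /s0 x0 /s0 y0; rewrite ler_pXn2r//; exact: ltW.
have s2sorted : sorted >=%R [seq x ^+ 2 | x <- s].
  rewrite sorted_map; apply: (sub_in_sorted (P := mem s) _ _ st);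
    last exact/allP.
  by move=> x y xs ys /=; exact: sq.
have s1sorted : sorted >=%R s1.
  rewrite rev_sorted sorted_map.
  apply: (sub_in_sorted (P := mem s) _ _ st); last exact/allP.
  move=> x y xs ys /= yx; rewrite lef_pV2 ?posrE ?exprn_gt0 ?s0//; exact: sq.
have s12 : s1 = [seq x ^+ 2 | x <- s].
  exact: (sorted_eq (@ge_trans _ R) (@ge_anti _ R)).
have si' : (size s - i.+1 < size s)%N by rewrite ltn_subrL (leq_ltn_trans _ si).
have := congr1 (nth 0^~ i) s12.
rewrite nth_rev size_map// (nth_map 0)// (nth_map 0)// -exprVn.
have ge0 k : (k < size s)%N -> 0 <= s`_k by move=> ks; exact/ltW/s0/mem_nth.
by move=> /eqP; rewrite eqrXn2 ?invr_ge0 ?ge0// => /eqP.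
Qed.

(* With [G] the signature and [Ka] the adjoint of a pseudo-unitary [K]: the
   inverse of [K^* K] is its conjugate by [G]. *)
Lemma signature_gram_inv (S : comNzRingType) n (G K Ka : 'M[S]_n) :
  G *m G = 1%:M -> Ka *m G *m K = G ->
  Ka *m K *m (G *m (Ka *m K) *m G) = 1%:M.
Proof.
move=> GG KG; have /mulmx1C KK' : G *m Ka *m G *m K = 1%:M.
  by rewrite -!mulmxA (mulmxA Ka) KG.
have -> : Ka *m K *m (G *m (Ka *m K) *m G) =
    Ka *m (K *m (G *m Ka *m (G *m G) *m K *m G)).
  by rewrite GG mulmx1 !mulmxA.
have -> : G *m Ka *m (G *m G) *m K *m G = (G *m Ka *m G) *m (G *m K *m G).
  by rewrite !mulmxA.
by rewrite (mulmxA K) KK' mul1mx !mulmxA KG.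
Qed.

Section SingularPairing.
Variables (R : realType) (d : nat).
Local Notation C := R[i].
Local Notation M2 := 'M[C]_(d + d).
Implicit Types T : M2.

Lemma det_unitary_diag n (P : 'M[C]_n) (D : 'rV[C]_n) : P \is unitarymx ->
  \det (P ^t* *m diag_mx D *m P) = \prod_i D 0 i.
Proof.
move=> Pu; rewrite !det_mulmx mulrAC -det_mulmx -(det_diag D).
suff -> : P ^t* *m P = 1%:M by rewrite det1 mul1r.
exact/mulmx1C/unitarymxP.
Qed.

Lemma char_poly_unitary n (P L : 'M[C]_n) : P \is unitarymx ->
  char_poly (P ^t* *m L *m P) = char_poly L.
Proof.
move=> Pu; have P1 : P ^t* *m P = 1%:M by exact/mulmx1C/unitarymxP.
rewrite /char_poly /char_poly_mx.
have -> : 'X%:M - map_mx (@polyC C) (P ^t* *m L *m P) =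
   map_mx (@polyC C) (P ^t*) *m ('X%:M - map_mx (@polyC C) L) *m map_mx
     (@polyC C) P.
  rewrite !map_mxM mulmxBr mulmxBl; congr (_ - _).
  by rewrite -mulmxA -scalar_mxC mulmxA -map_mxM P1 map_mx1 mul1mx.
by rewrite !det_mulmx mulrAC -det_mulmx -map_mxM P1 map_mx1 det1 mul1r.
Qed.

Lemma char_poly_unitary_diag n (P : 'M[C]_n) (D : 'rV[C]_n) : P \is unitarymx ->
  char_poly (P ^t* *m diag_mx D *m P) =
  \prod_(x <- [seq D 0 i | i <- enum 'I_n]) ('X - x%:P).
Proof.
move=> Pu; rewrite char_poly_unitary// big_map big_enum /=.
rewrite char_poly_trig ?diag_mx_is_trig//.
by apply: eq_bigr => i _; rewrite mxE eqxx.
Qed.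

Lemma HSp_gram T : HSp T -> HSp (T ^t* *m T).
Proof. by move=> TH; apply: HSpM => //; exact: HSp_adj. Qed.

Lemma HSp_prod_singval T : HSp T -> \prod_(i < d + d) singval T i ^+ 2 = 1.
Proof.
move=> TH; have [P Pu TE] := gram_spectral_sorted T.
apply: (@complexI R); rewrite rmorph_prod /=.
transitivity (\det (T ^t* *m T)).
  by rewrite TE det_unitary_diag//; apply: eq_bigr => i _; rewrite !mxE.
by rewrite det_mulmx det_adj HSp_det.
Qed.

Lemma HSp_singval_gt0 T i : HSp T -> (i < d + d)%N -> 0 < singval T i.
Proof.
move=> TH id; rewrite lt_neqAle singval_ge0 andbT eq_sym.
apply/eqP => s0; have := HSp_prod_singval TH.
rewrite (bigD1 (Ordinal id)) //= s0 expr0n mul0r => /eqP.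
by rewrite eq_sym oner_eq0.
Qed.

(** The left side is the inverse of [T^* T], which is itself Hermitian-symplectic; the same unitary
    diagonalizes it, with inverted eigenvalues. *)
Lemma HSp_gram_inv T (P : M2) : HSp T -> P \is unitarymx ->
  T ^t* *m T = P ^t* *m diag_mx
    (map_mx (real_complex R) (\row_i singval T i ^+ 2)) *m P ->
  - symplJ R d *m (T ^t* *m T) *m symplJ R d =
  P ^t* *m diag_mx (map_mx (real_complex R) (\row_i (singval T i) ^- 2)) *m P.
Proof.
move=> TH Pu TE.
have := HSp_mulKl (HSp_gram TH); rewrite adjM adjK.
set X := - _ *m _ *m _ => HX; set Y := RHS.
have HY : Y *m (T ^t* *m T) = 1%:M.
  rewrite TE /Y -!mulmxA (mulmxA P (P ^t*)) (unitarymxP Pu) mul1mx.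
  rewrite (mulmxA (diag_mx _)) mulmx_diag.
  suff -> : diag_mx (\row_j
    ((map_mx (real_complex R) (\row_i singval T i ^- 2)) 0 j *
              (map_mx (real_complex R) (\row_i singval T i ^+ 2)) 0 j)) =
                1%:M :> M2.
    by rewrite mul1mx; exact/mulmx1C/unitarymxP.
  rewrite -diag_const_mx; congr diag_mx; apply/rowP => i; rewrite !mxE.
  rewrite -rmorphM mulVf ?rmorph1//.
  by rewrite expf_neq0// gt_eqF// HSp_singval_gt0.
by rewrite -[X]mul1mx -HY -mulmxA HX mulmx1.
Qed.

(** Since [- J] is the inverse of [J], the inverse of [T^* T] is also similar to [T^* T]. The
    multiset of eigenvalues is thus stable under inversion, which reverses their order. *)
Lemma HSp_singval_rev T (i : 'I_(d + d)) : HSp T ->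
  singval T (rev_ord i) = (singval T i)^-1.
Proof.
move=> TH; have [P Pu TE] := gram_spectral_sorted T.
have := HSp_gram_inv TH Pu TE; set Hi := (LHS) => HiE.
have cpE : char_poly Hi = char_poly (T ^t* *m T).
  rewrite /char_poly /char_poly_mx /Hi.
  set J := map_mx (@polyC C) (symplJ R d).
  have JJ : - J *m J = 1%:M.
    rewrite /J -map_mxN -map_mxM mulNmx symplJ_sqr opprK map_mx1//.
  have -> : 'X%:M - map_mx (@polyC C)
    (- symplJ R d *m (T ^t* *m T) *m symplJ R d) =
      - J *m ('X%:M - map_mx (@polyC C) (T ^t* *m T)) *m J.
    rewrite (map_mxM _ _ (symplJ R d)) (map_mxM _ (- _)) map_mxN -/J.
    rewrite mulmxBr mulmxBl; congr (_ - _).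
    by rewrite -mulmxA -scalar_mxC mulmxA JJ mul1mx.
  by rewrite !det_mulmx mulrAC -det_mulmx JJ det1 mul1r.
have : perm_eq [seq singval T i ^- 2 | i <- iota 0 (d + d)]
               [seq singval T i ^+ 2 | i <- iota 0 (d + d)].
  apply: (perm_map_inj (@complexI R)); rewrite -!map_comp.
  apply: prod_XsubC_eq; move: cpE; rewrite HiE TE !char_poly_unitary_diag//.
  rewrite -val_enum_ord -!map_comp.
  rewrite (@eq_map _ _ _ (fun i : 'I_(d + d) => (singval T i ^- 2)%:C%C));
    last first.
    by move=> j /=; rewrite !mxE.
  rewrite [X in _ = \big[_/_]_(_ <- X) _](@eq_map _ _ _
    (fun i : 'I_(d + d) => (singval T i ^+ 2)%:C%C)); last first.
    by move=> j /=; rewrite !mxE.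
  by [].
have -> : [seq singval T i ^- 2 | i <- iota 0 (d + d)] =
    [seq x ^- 2 | x <- singvals T].
  rewrite -[singvals T](mkseq_nth 0) /mkseq -map_comp size_singvals.
  exact: eq_map.
have -> : [seq singval T i ^+ 2 | i <- iota 0 (d + d)] =
    [seq x ^+ 2 | x <- singvals T].
  rewrite -[in RHS](mkseq_nth 0 (singvals T)) /mkseq -map_comp size_singvals.
  exact: eq_map.
move=> /(sorted_perm_inv _ _) inv.
have := inv _ _ (rev_ord i); rewrite size_singvals.
move=> /(_ _ _ (ltn_ord _)) E; rewrite {1}/singval E.
- by congr (singval T _)^-1; have := congr1 val (rev_ordK i).
- by apply: sort_sorted => x y; exact: le_total.
- by apply/allP => x /(nthP 0)[j]; rewrite size_singvals => jd <-;
    exact: HSp_singval_gt0.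
Qed.

(** The partner [s^-1] of [s] stands later in the decreasing order. *)
Lemma HSp_singval_ge1 T i : HSp T -> (i < d)%N -> 1 <= singval T i.
Proof.
move=> TH id; have id2 : (i < d + d)%N by rewrite ltn_addr.
have s0 := HSp_singval_gt0 TH id2.
have : singval T (rev_ord (Ordinal id2)) <= singval T i.
  by apply: singval_le => /=; lia.
rewrite HSp_singval_rev//= => sle.
have := ler_wpM2l (ltW s0) sle; rewrite divff ?gt_eqF// -expr2.
by rewrite -[X in X <= _](expr1n _ 2) ler_pXn2r// nnegrE ltW.
Qed.

Lemma normc_conj (z : C) : normc z^* = normc z.
Proof. by apply: (@complexI R); rewrite !normcE norm_conjC. Qed.

Lemma HSp_normc_det T : HSp T -> normc (\det T) = 1.
Proof.
move=> /HSp_det /(congr1 (@normc R)); rewrite normcM normc_conj -expr2.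
rewrite [in RHS](_ : normc 1 = 1 ^+ 2); last first.
  by rewrite expr1n; exact: ComplexField.Normc.normc1.
by move=> /eqP; rewrite eqrXn2 ?normc_ge0// => /eqP.
Qed.

(** With [H = K^* K], the identity [(H + 1)^2 = H (H + H^-1 + 2)] and the block form of the last
    factor give [det (H + 1) = 4^d |det E|^2], as [det H = 1] and [|det A| = |det E|]. On the other
    side, [det (H + 1)] is the product of all [s_i^2 + 1], that is, since the [s_i] multiply to 1,
    [4^d] times the product of all [(s_i + s_i^-1) / 2]. The pairing makes the latter a square. *)
Lemma HSp_prod_Nsum T : HSp T ->
  \prod_(i < d) ((singval T i + (singval T i)^-1) / 2) =
  normc (\det (drsubmx (cay T))).
Proof.
move=> TH; set p := LHS; set K := cay T.
have KG := cay_HSp TH; rewrite -/K in KG.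
pose a := normc (\det (ulsubmx K)); pose e := normc (\det (drsubmx K)).
have KE : K = block_mx (ulsubmx K) (ursubmx K) (dlsubmx K) (drsubmx K).
  by rewrite submxK.
have aE : a = e.
  rewrite KE in KG; have := pseudo_unitary_det KG; rewrite -KE.
  by move=> /(congr1 (@normc R));
    rewrite normcM normc_conj det_cay HSp_normc_det// mul1r.
have [P Pu TE] := gram_spectral_sorted T.
have det1H : \det (T ^t* *m T + 1%:M) =
  (\prod_(i < d + d) (singval T i ^+ 2 + 1))%:C%C.
  have -> : T ^t* *m T + 1%:M =
      P ^t* *m diag_mx (map_mx (real_complex R) (\row_i (singval T i ^+ 2 + 1)))
        *m P.
    have -> : diag_mx (map_mx (real_complex R) (\row_i (singval T i ^+ 2 + 1)))
      =
       diag_mx (map_mx (real_complex R) (\row_i (singval T i ^+ 2))) +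
         1%:M :> M2.
      rewrite -diag_const_mx -raddfD /=; congr diag_mx; apply/rowP => i.
      by rewrite !mxE rmorphD rmorph1.
    rewrite mulmxDr mulmxDl -TE mulmx1; congr (_ + _).
    exact/esym/mulmx1C/unitarymxP.
  rewrite det_unitary_diag// rmorph_prod; apply: eq_bigr => i _.
  by rewrite !mxE.
have Kgram : K ^t* *m K = cay (T ^t* *m T) by rewrite cayM cay_adj.
have detK1 : \det (K ^t* *m K + 1%:M) =
  (\prod_(i < d + d) (singval T i ^+ 2 + 1))%:C%C.
  by rewrite Kgram -(cay1 R d) -cayD det_cay det1H.
have detK : (\det K)^* * \det K = 1 by rewrite det_cay; exact: HSp_det.
clearbody K.
have gram : K ^t* *m K + sgnG R d *m (K ^t* *m K) *m sgnG R d + 2%:R *: 1%:M =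
  4%:R *: block_mx ((ulsubmx K) ^t* *m ulsubmx K) 0 0
    ((drsubmx K) ^t* *m drsubmx K).
  by rewrite KE in KG; have := pseudo_unitary_gram KG; rewrite -KE.
have HW : K ^t* *m K *m (sgnG R d *m (K ^t* *m K) *m sgnG R d) = 1%:M.
  exact: signature_gram_inv (sgnG_sqr R d) KG.
have sq : (K ^t* *m K + 1%:M) *m (K ^t* *m K + 1%:M) = K ^t* *m K *m
   (K ^t* *m K + sgnG R d *m (K ^t* *m K) *m sgnG R d + 2%:R *: 1%:M).
  rewrite [RHS]mulmxDr [in RHS]mulmxDr HW; move: (K ^t* *m K) => H.
  rewrite mulmxDr mulmxDl mulmx1 mul1mx -scalemxAr mulmx1.
  by move: (H *m H) => HH; apply/matrixP => i j; rewrite !mxE; ring.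
move: sq; rewrite gram => /(congr1 determinant).
rewrite det_mulmx detK1 det_mulmx det_mulmx det_adj detK.
rewrite mul1r detZ det_ublock !det_mulmx !det_adj.
rewrite ![_^* * _]mulrC -!sqr_normcE -/a -/e aE -!rmorphM.
have -> : (4%:R : C) ^+ (d + d) = ((4%:R : R) ^+ (d + d))%:C%C
  by rewrite rmorphXn /= rmorph_nat.
rewrite -rmorphM => /(@complexI R).
set q := \prod_(i < d + d) _ => qE.
have q_gt0 : 0 < q by apply: prodr_gt0 => i _; rewrite ltr_wpDl// sqr_ge0.
have {}qE : q = 4%:R ^+ d * e ^+ 2.
  apply/eqP; rewrite -(@eqrXn2 _ 2)// ?(ltW q_gt0) ?mulr_ge0 ?exprn_ge0
    ?normc_ge0//.
  by apply/eqP; rewrite expr2 qE exprD; ring.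
have p0 : 0 <= p.
  apply: prodr_ge0 => i _; apply: divr_ge0 => //; apply: addr_ge0.
    exact: singval_ge0.
  by rewrite invr_ge0 singval_ge0.
apply/eqP; rewrite -(@eqrXn2 _ 2)// ?normc_ge0// -/e; apply/eqP.
pose f (i : 'I_(d + d)) := (singval T i + (singval T i)^-1) / 2.
(* The indices from [d] on are the reflections of those below [d]; there [s] becomes [s^-1] and [f]
   keeps its value. *)
transitivity (\prod_i f i).
  rewrite big_split_ord /= [X in _ = _ * X](reindex_inj rev_ord_inj) /= expr2.
  congr (_ * _); apply: eq_bigr => i _; rewrite /f /=.
  have := HSp_singval_rev (lshift d i) TH; rewrite /=.
  have -> : (d + d - i.+1 = d + (d - i.+1))%N by have := ltn_ord i; lia.
  by move=> ->; rewrite invrK addrC.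
have s1 : \prod_(i < d + d) singval T i = 1.
  apply/eqP; rewrite -(@eqrXn2 _ 2)// ?expr1n ?ler01//; last first.
    by apply: prodr_ge0 => i _; exact: singval_ge0.
  by rewrite -prodrXl HSp_prod_singval.
have : \prod_i f i * (\prod_(i < d + d) singval T i) * 4%:R ^+ d = q.
  rewrite -big_split /= (_ : 4%:R ^+ d = \prod_(i < d + d) (2 : R)); last first.
    by rewrite prodr_const card_ord exprD -exprMn; congr (_ ^+ _);
      rewrite -natrM.
  rewrite -big_split /=; apply: eq_bigr => i _; rewrite /f.
  by field; rewrite gt_eqF// HSp_singval_gt0.
rewrite s1 mulr1 qE mulrC => /(mulfI _); apply.
by rewrite expf_neq0// pnatr_eq0.
Qed.

End SingularPairing.

(** * Jensen's formula *)

Section IntervalIntegrals.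
Variable R : realType.
Notation mu := (@lebesgue_measure R).
Implicit Types (g : R -> R) (a b c s : R).

Lemma continuous_itv_integrable g a b : continuous g ->
  mu.-integrable `[a, b] (EFin \o g).
Proof.
move=> cg; apply: continuous_compact_integrable; first exact: segment_compact.
by apply: continuous_subspaceT => x; exact: cg.
Qed.

Lemma Rintegral_affine g s c a b : 0 < s -> a <= b -> continuous g ->
  \int[mu]_(x in `[s * a + c, s * b + c]) g x =
  s * \int[mu]_(x in `[a, b]) g (s * x + c).
Proof.
move=> s0 ab cg; pose F x := s * x + c.
have dF (x : R) : is_derive x 1 F s.
  suff : is_derive x 1 (s \*: (@idfun R) + cst c) s by [].
  by apply: is_derive_eq; rewrite addr0 /GRing.scale /= mulr1.
have F'E : derive1 F = cst s by apply/funext => x; rewrite derive1E derive_val.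
have cF : continuous F.
  move=> x; apply: differentiable_continuous; apply/derivable1_diffP.
  exact: ex_derive.
have cgF : continuous (g \o F)
  by move=> x; apply: continuous_comp; [exact: cF|exact: cg].
have <- := @RintegralZl _ _ R mu `[a, b]%classic (g \o F) s (measurable_itv _)
  (continuous_itv_integrable _ _ cgF).
rewrite /Rintegral (@integration_by_substitution_increasing _ F)//.
- by congr fine; apply: eq_integral => x _; rewrite F'E /= mulrC.
- by move=> x y _ _ xy; rewrite /F ltrD2r ltr_pM2l.
- by rewrite F'E => x _; exact: cst_continuous.
- by rewrite F'E; exact: is_cvg_cst.
- by rewrite F'E; exact: is_cvg_cst.
- split => //.
  + by apply: cvg_at_right_filter; exact: cF.
  + by apply: cvg_at_left_filter; exact: cF.
- by apply: continuous_subspaceT => x; exact: cg.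
Qed.

Lemma Rintegral_split g a b c : a <= b -> b <= c -> continuous g ->
  \int[mu]_(x in `[a, c]) g x =
  \int[mu]_(x in `[a, b]) g x + \int[mu]_(x in `[b, c]) g x.
Proof.
move=> ab bc cg; have ig := continuous_itv_integrable _ _ cg.
apply/eqP; rewrite addrC -subr_eq; apply/eqP.
rewrite Rintegral_itvB ?bnd_simp// Rintegral_itv_obnd_cbnd//.
by apply: integrableS (ig b c) => //; exact: subset_itv_oc_cc.
Qed.

End IntervalIntegrals.

Section ComplexContinuity.
Variables (R : realType) (T : topologicalType).
Implicit Types f g : T -> R[i].

(** Stated through real and imaginary parts, so that no topology on [R[i]] is involved. *)
Definition ccont f :=
  continuous (fun x => complex.Re (f x)) /\ continuous
    (fun x => complex.Im (f x)).

Lemma ccont_cst z : ccont (fun=> z).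
Proof. by split=> x; exact: cvg_cst. Qed.

Lemma ccontM f g : ccont f -> ccont g -> ccont (fun x => f x * g x).
Proof.
move=> [f1 f2] [g1 g2]; split.
  rewrite (_ : (fun x => _) = (fun x => complex.Re (f x) * complex.Re (g x) -
    complex.Im (f x) * complex.Im (g x))).
    by move=> x; apply: cvgB; apply: cvgM;
      [exact: f1|exact: g1|exact: f2|exact: g2].
  by apply/funext => x; case: (f x) (g x) => [a b] [c e].
rewrite (_ : (fun x => _) = (fun x => complex.Re (f x) * complex.Im (g x) +
    complex.Im (f x) * complex.Re (g x))).
  by move=> x; apply: cvgD; apply: cvgM;
    [exact: f1|exact: g2|exact: f2|exact: g1].
by apply/funext => x; case: (f x) (g x) => [a b] [c e].
Qed.

Lemma ccontD f g : ccont f -> ccont g -> ccont (fun x => f x + g x).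
Proof.
move=> [f1 f2] [g1 g2]; split.
  rewrite (_ : (fun x => _) = (fun x => complex.Re (f x) + complex.Re (g x))).
    by move=> x; apply: cvgD; [exact: f1|exact: g1].
  by apply/funext => x; case: (f x) (g x) => [a b] [c e].
rewrite (_ : (fun x => _) = (fun x => complex.Im (f x) + complex.Im (g x))).
  by move=> x; apply: cvgD; [exact: f2|exact: g2].
by apply/funext => x; case: (f x) (g x) => [a b] [c e].
Qed.

Lemma normc_sqrtE (z : R[i]) :
  normc z = Num.sqrt (complex.Re z ^+ 2 + complex.Im z ^+ 2).
Proof. by case: z. Qed.

Lemma continuous_ln_normc f : ccont f -> (forall x, f x != 0) ->
  continuous (fun x => ln (normc (f x))).
Proof.
move=> [f1 f2] f0 x; have n0 : 0 < normc (f x).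
  by rewrite lt_neqAle normc_ge0 eq_sym normc_eq0 f0.
apply: (@continuous_comp _ _ _ (fun x => normc (f x)) (@ln R));
  last exact: continuous_ln.
rewrite (_ : (fun x => _) = (fun x => Num.sqrt
   (complex.Re (f x) * complex.Re (f x) + complex.Im (f x) *
     complex.Im (f x)))).
  apply: continuous_comp; last exact: sqrt_continuous.
  by apply: cvgD; apply: cvgM; [exact: f1|exact: f1|exact: f2|exact: f2].
by apply/funext => y; rewrite normc_sqrtE !expr2.
Qed.

End ComplexContinuity.

(** * Logarithmic means over the unit circle *)

Section Jensen.
Variable R : realType.
Notation mu := (@lebesgue_measure R).
Local Notation C := R[i].

(** This is [e^(i pi theta)]; its square runs once around the unit circle for [theta] in
    [[0, 1]]. *)
Definition expi (theta : R) : C := rot_c theta + 'i%C * rot_s theta.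

Lemma expiE theta :
  expi theta = Complex (cos (pi * theta)) (sin (pi * theta)).
Proof. by rewrite /expi /rot_c /rot_s [RHS]complexE. Qed.

Lemma normc_expi theta : normc (expi theta) = 1.
Proof. by rewrite expiE normc_sqrtE /= cos2Dsin2 sqrtr1. Qed.

Lemma expi_double theta : expi (2 * theta) = expi theta ^+ 2.
Proof.
rewrite !expiE expr2; apply/eqP; rewrite eq_complex /=.
rewrite (_ : pi * (2 * theta) = pi * theta + pi * theta); last by ring.
rewrite cosD sinD.
by apply/andP; split; apply/eqP; ring.
Qed.

Lemma expi_half theta : expi (theta + 2^-1) ^+ 2 = - expi theta ^+ 2.
Proof.
rewrite !expiE !expr2; apply/eqP; rewrite eq_complex /=.
rewrite mulrDr cosDpihalf sinDpihalf.
by apply/andP; split; apply/eqP; ring.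
Qed.

Lemma ccont_expi : ccont expi.
Proof.
have cp : continuous (fun x : R => pi * x).
  by move=> x; apply: cvgM; [exact: cvg_cst|exact: cvg_id].
split.
  rewrite (_ : (fun x => _) = cos \o (fun x : R => pi * x)).
    by move=> x; apply: continuous_comp; [exact: cp|exact: continuous_cos].
  by apply/funext => x; rewrite expiE.
rewrite (_ : (fun x => _) = sin \o (fun x : R => pi * x)).
  by move=> x; apply: continuous_comp; [exact: cp|exact: continuous_sin].
by apply/funext => x; rewrite expiE.
Qed.

Definition lnfac (b : C) (theta : R) := ln (normc (1 - b * expi theta ^+ 2)).

Lemma lerB_normc (u v : C) : normc u - normc v <= normc (u - v).
Proof. by rewrite -lecR rmorphB /= !normcE; exact: lerB_dist. Qed.

Lemma normcB_le (u v : C) : normc (u - v) <= normc u + normc v.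
Proof. by rewrite -lecR rmorphD /= !normcE; exact: ler_normB. Qed.

Lemma normc_factor_bounds b theta : 
  1 - normc b <= normc (1 - b * expi theta ^+ 2) <= 1 + normc b.
Proof.
have e : normc (b * expi theta ^+ 2) = normc b.
  by rewrite expr2 !normcM normc_expi !mulr1.
rewrite -e; have n1 : normc (1 : C) = 1 by exact: ComplexField.Normc.normc1.
rewrite -n1; apply/andP; split; first exact: lerB_normc.
exact: normcB_le.
Qed.

Lemma factor_neq0 b theta : normc b < 1 -> 1 - b * expi theta ^+ 2 != 0.
Proof.
move=> b1; rewrite -normc_eq0 gt_eqF//.
by apply: lt_le_trans (andP (normc_factor_bounds b theta)).1; rewrite subr_gt0.
Qed.

Lemma continuous_lnfac b : normc b < 1 -> continuous (lnfac b).
Proof.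
move=> b1; apply: continuous_ln_normc => [|x]; last exact: factor_neq0.
under eq_fun => x do rewrite expr2 -mulNr.
apply: ccontD; first exact: ccont_cst.
by apply: ccontM; [exact: ccont_cst|apply: ccontM; exact: ccont_expi].
Qed.

(** With [z = expi theta ^+ 2], half a period turns [z] into [- z], and
    [(1 - b z) (1 + b z) = 1 - b^2 z^2]. *)
Lemma lnfac_double b theta : normc b < 1 ->
  lnfac b theta + lnfac b (theta + 2^-1) = lnfac (b ^+ 2) (2 * theta).
Proof.
move=> b1; rewrite /lnfac -lnM ?posrE ?lt_neqAle ?normc_ge0 1?eq_sym ?normc_eq0
  ?factor_neq0//.
rewrite -normcM expi_double expi_half; congr (ln (normc _)); ring.
Qed.

(** The upper half of the interval is shifted onto the lower one, where the two logarithms combine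
    into one at the doubled angle; rescaling produces the factor 1/2. *)
Lemma Rintegral_lnfac_double b : normc b < 1 ->
  \int[mu]_(x in `[0, 1]) lnfac b x =
  2^-1 * \int[mu]_(x in `[0, 1]) lnfac (b ^+ 2) x.
Proof.
move=> b1; have cb := continuous_lnfac b1.
have b21 : normc (b ^+ 2) < 1.
  by rewrite expr2 normcM -expr2 exprn_ilt1// normc_ge0.
have cb2 := continuous_lnfac b21.
have h0 : (0 : R) <= 2^-1 by rewrite invr_ge0.
rewrite (@Rintegral_split _ _ 0 2^-1)//; last by rewrite invf_le1// ler1n.
have -> : \int[mu]_(x in `[2^-1, 1]) lnfac b x =
    \int[mu]_(x in `[0, 2^-1]) lnfac b (x + 2^-1).
  have := @Rintegral_affine R (lnfac b) 1 2^-1 0 2^-1 ltr01 h0 cb.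
  rewrite !mul1r add0r (_ : 2^-1 + 2^-1 = 1 :> R); last by field.
  by move=> ->; apply: eq_Rintegral => x _; rewrite mul1r.
have := @Rintegral_affine R (lnfac (b ^+ 2)) 2 0 0 2^-1 (ltr0Sn _ _) h0 cb2.
rewrite mulr0 !addr0 divff// => ->; rewrite mulrA mulVf// mul1r.
rewrite -RintegralD//.
- by apply: eq_Rintegral => x _; rewrite addr0 lnfac_double.
- exact: continuous_itv_integrable.
- apply: (@continuous_itv_integrable R (fun x : R => lnfac b (x + 2^-1))) => x.
  apply: (@continuous_comp R R R (fun x => x + 2^-1) (lnfac b)); last exact: cb.
  by apply: cvgD; [exact: cvg_id|exact: cvg_cst].
Qed.

(* Doubling gives [I b = I (b ^+ 2) / 2] for the integral [I b], and [I] is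
   bounded on [normc c <= normc b]; hence [I b = 0]. *)
Lemma Rintegral_lnfac b : normc b < 1 -> \int[mu]_(x in `[0, 1]) lnfac b x = 0.
Proof.
move=> b1; set r := normc b.
have r0 : 0 <= r := normc_ge0 b.
(* From [1 - r <= |1 - c z| <= 1 + r]; valid for all [|c| <= r], hence for all iterated squares of
   [b] at once. *)
pose K := Num.max (- ln (1 - r)) (ln (1 + r)).
have bound c : normc c <= r -> `|\int[mu]_(x in `[0, 1]) lnfac c x| <= K.
  move=> cr; have c1 : normc c < 1 by apply: le_lt_trans cr b1.
  have cc := continuous_lnfac c1.
  apply: le_trans (le_normr_Rintegral _ _) _ => //.
    exact: continuous_itv_integrable.
  have -> : K = \int[mu]_(x in `[0, 1]) cst K x.
    rewrite Rintegral_cst//= lebesgue_measure_itv /= lte_fin ltr01.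
    by rewrite sube0 mulr1.
  apply: le_Rintegral => //.
  - apply: continuous_itv_integrable => x; apply: continuous_comp;
      first exact: cc.
    exact: norm_continuous.
  - by apply: continuous_itv_integrable; exact: cst_continuous.
  move=> x _; have /andP[lo hi] := normc_factor_bounds c x.
  have lo0 : 0 < normc (1 - c * expi x ^+ 2)
    by apply: lt_le_trans lo; rewrite subr_gt0.
  rewrite ler_norml /lnfac; apply/andP; split.
    rewrite lerNl; apply: le_trans (_ : - ln (1 - r) <= _); last
      by rewrite le_max lexx.
    rewrite lerN2 ler_ln ?posrE ?subr_gt0//; apply: le_trans lo.
    by rewrite lerB.
  apply: le_trans (_ : ln (1 + r) <= _); last by rewrite le_max lexx orbT.
  rewrite ler_ln ?posrE ?ltr_pwDl//; apply: (le_trans hi).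
  by rewrite lerD2l.
have iter n c : normc c <= r ->
  `|\int[mu]_(x in `[0, 1]) lnfac c x| <= 2^-1 ^+ n * K.
  elim: n c => [|n IH] c cr; first by rewrite expr0 mul1r bound.
  rewrite Rintegral_lnfac_double; last exact: le_lt_trans b1.
  rewrite normrM (exprS _ n) -mulrA.
  rewrite ger0_norm ?invr_ge0// ler_wpM2l ?invr_ge0//; apply: IH.
  rewrite expr2 normcM; apply: (le_trans _ cr); rewrite ler_piMr ?normc_ge0//.
  exact/ltW/(le_lt_trans cr).
apply/eqP; rewrite -normr_le0.
have lim0 : (2^-1 ^+ n * K) @[n --> \oo] --> (0 : R).
  rewrite -(mul0r K); apply: cvgM; last exact: cvg_cst.
  by apply: cvg_expr; rewrite ger0_norm ?invr_ge0// invf_lt1// ltr1n.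
apply: (ler_cvg_to (cvg_cst _) lim0).
by apply: nearW => n; exact: iter.
Qed.

Lemma normc1 : normc (1 : C) = 1.
Proof. exact: ComplexField.Normc.normc1. Qed.

Lemma normcN (z : C) : normc (- z) = normc z.
Proof. by apply: (@complexI R); rewrite !normcE normrN. Qed.

Lemma normcV (z : C) : normc z^-1 = (normc z)^-1.
Proof. exact: ComplexField.Normc.normcV. Qed.

Lemma normc_gt0 (z : C) : (0 < normc z) = (z != 0).
Proof. by rewrite lt_neqAle normc_ge0 andbT eq_sym normc_eq0. Qed.

Lemma prod_factors_neq0 (r : seq C) : (forall z, z \in r -> 1 < normc z) ->
  forall e : C, normc e <= 1 -> \prod_(y <- r) (e - y) != 0.
Proof.
move=> r1 e e1; rewrite prodf_seq_neq0; apply/allP => y yr /=.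
by rewrite subr_eq0; apply: contraL (r1 _ yr) => /eqP <-; rewrite -leNgt.
Qed.

(** Write [w - z = - z (1 - z^-1 w)] for a root [z]: as [|z^-1| < 1], the logarithm of the second
    factor has mean zero on the circle, and [ln |z|] is the value at [w = 0]. *)
Lemma ln_normc_prod_factors (r : seq C) : (forall z, z \in r -> 1 < normc z) ->
  let G x := ln (normc (\prod_(z <- r) (expi x ^+ 2 - z))) in
  continuous G /\
  \int[mu]_(x in `[0, 1]) G x = ln (normc (\prod_(z <- r) (0 - z))).
Proof.
elim: r => [_|z r IH] /=.
  rewrite big_nil normc1 ln1; under eq_fun do rewrite big_nil normc1 ln1.
  split; first exact: cst_continuous.
  by rewrite Rintegral_cst// mul0r.
move=> r1; have z1 : 1 < normc z by rewrite r1// mem_head.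
have {}r1 y : y \in r -> 1 < normc y by move=> yr; rewrite r1// in_cons yr orbT.
have [cG IG] := IH r1; have z0 : z != 0.
  by rewrite -normc_gt0 (lt_trans ltr01).
have iz1 : normc z^-1 < 1 by rewrite normcV invf_lt1// (lt_trans ltr01).
have prod0 := prod_factors_neq0 r1.
have e1 x : normc (expi x ^+ 2) <= 1 by rewrite expr2 normcM normc_expi mulr1.
have GE x : ln (normc (\prod_(y <- z :: r) (expi x ^+ 2 - y))) =
    ln (normc z) + lnfac z^-1 x + ln (normc (\prod_(y <- r) (expi x ^+ 2 - y))).
  rewrite big_cons normcM lnM ?posrE ?normc_gt0 ?prod0//; last first.
    rewrite subr_eq0; apply: contraL z1 => /eqP <-; by rewrite -leNgt.
  congr (_ + _); rewrite -lnM ?posrE ?normc_gt0//; last exact: factor_neq0.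
  rewrite -normcM -normcN; congr (ln (normc _)).
  by rewrite mulrBr mulr1 mulrA divff// mul1r opprB.
have cz := continuous_lnfac iz1.
have cz' : continuous (fun x : R => ln (normc z) + lnfac z^-1 x).
  by move=> x; apply: cvgD; [exact: cvg_cst|exact: cz].
under eq_fun do rewrite GE.
split; first by move=> x; apply: cvgD; [exact: cz'|exact: cG].
rewrite RintegralD//; try exact: continuous_itv_integrable.
rewrite RintegralD//; try exact: continuous_itv_integrable; last first.
  by apply: continuous_itv_integrable; exact: cst_continuous.
rewrite Rintegral_cst//= lebesgue_measure_itv /= lte_fin ltr01 sube0 mulr1.
rewrite Rintegral_lnfac// addr0 IG big_cons normcM lnM ?posrE ?normc_gt0//.
- by rewrite sub0r normcN.
- by rewrite sub0r oppr_eq0.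
- by apply: prod0; rewrite [X in X <= _]ComplexField.Normc.normc0 ler01.
Qed.

Lemma Jensen_poly (q : {poly C}) : (forall z, normc z <= 1 -> q.[z] != 0) ->
  continuous (fun x => ln (normc q.[expi x ^+ 2])) /\
  (\int[mu]_(x in `[0%R, 1%R]) (ln (normc q.[expi x ^+ 2]))%:E =
    (ln (normc q.[0]))%:E)%E.
Proof.
move=> qn0; have [r qE] := closed_field_poly_normal q.
have n0 : normc (0 : C) = 0 by exact: ComplexField.Normc.normc0.
have q0 : lead_coef q != 0.
  rewrite lead_coef_eq0; apply: contra (qn0 0 _); last by rewrite n0.
  by move=> /eqP ->; rewrite horner0.
have r1 z : z \in r -> 1 < normc z.
  move=> zr; rewrite ltNge; apply/negP => /qn0.
  by rewrite qE hornerZ -/(root _ _) mulf_eq0 negb_or -/(root _ _)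
    root_prod_XsubC zr andbF.
have [cG IG] := ln_normc_prod_factors r1.
have prod0 := prod_factors_neq0 r1.
have hornE (e : C) : normc e <= 1 ->
   ln (normc q.[e]) =
     ln (normc (lead_coef q)) + ln (normc (\prod_(z <- r) (e - z))).
  move=> e1; rewrite -lnM ?posrE ?normc_gt0 ?prod0// -normcM {1}qE hornerZ.
  by rewrite horner_prod; congr (ln (normc (_ * _))); apply: eq_bigr => z _;
    rewrite hornerXsubC.
have e1 x : normc (expi x ^+ 2) <= 1 by rewrite expr2 normcM normc_expi mulr1.
have cq : continuous (fun x => ln (normc q.[expi x ^+ 2])).
  under eq_fun do rewrite hornE//.
  by move=> x; apply: cvgD; [exact: cvg_cst|exact: cG].
split => //; rewrite -[LHS]fineK; last first.
  by apply: integrable_fin_num => //; exact: continuous_itv_integrable.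
congr EFin; rewrite -[LHS]/(Rintegral _ _ _).
under eq_Rintegral do rewrite hornE//.
rewrite RintegralD//; try exact: continuous_itv_integrable; last first.
  by apply: continuous_itv_integrable; exact: cst_continuous.
rewrite IG Rintegral_cst//= lebesgue_measure_itv /= lte_fin ltr01 sube0 mulr1.
by rewrite hornE// n0.
Qed.

End Jensen.

(** * Products with rotations *)

Section RotatedProducts.
Variables (R : realType) (d : nat).
Notation mu := (@lebesgue_measure R).
Local Notation C := R[i].
Local Notation M2 := 'M[C]_(d + d).
Implicit Types (T : M2) (s : seq M2).

Lemma ln_prod_gt0 n (f : 'I_n -> R) : (forall i, 0 < f i) ->
  \sum_i ln (f i) = ln (\prod_i f i).
Proof.
move=> f0; suff [] : \sum_i ln (f i) = ln (\prod_i f i) /\ 0 < \prod_i f i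
  by [].
elim/big_ind2: _ => [|x u y v [-> u0] [-> v0]|i _]; first by rewrite ln1.
- by rewrite lnM// mulr_gt0.
- by split.
Qed.

Lemma Nsum_ln_det T : HSp T -> Nsum d T = ln (normc (\det (drsubmx (cay T)))).
Proof.
move=> TH; rewrite -HSp_prod_Nsum// -ln_prod_gt0// => i.
have s1 := HSp_singval_ge1 TH (ltn_ord i).
by rewrite divr_gt0// addr_gt0 ?invr_gt0// (lt_le_trans ltr01).
Qed.

(** Indexed by sequences, so that one formula covers a finite family, its repetitions (powers of the
    product) and the orbits of a cocycle. *)
Definition rotprod (theta : R) s : M2 :=
  \big[mulmx/1%:M]_(T <- s) (rotmx d theta *m T).

Definition hsp_seq s := forall T, T \in s -> HSp T.

Lemma hsp_seq_cons T s : hsp_seq (T :: s) -> HSp T /\ hsp_seq s.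
Proof.
move=> h; split; first by apply: h; rewrite mem_head.
by move=> T' T's; apply: h; rewrite in_cons T's orbT.
Qed.

Lemma HSp_rotprod theta s : hsp_seq s -> HSp (rotprod theta s).
Proof.
rewrite /rotprod; elim: s => [_|T s IH /hsp_seq_cons[TH sH]].
  by rewrite big_nil; exact: HSp1.
rewrite big_cons; apply: HSpM; last exact: IH.
by apply: HSpM => //; exact: HSp_rotmx.
Qed.

(** The Cayley transform of [rotprod] without its scalar phases, with [expi theta ^+ 2] freed to an
    arbitrary complex [z]. *)
Definition zprod (z : C) s : M2 :=
  \big[mulmx/1%:M]_(T <- s) (sblock d z 0 0 1 *m cay T).

Lemma expiJ (theta : R) : (expi theta)^* = rot_c theta - 'i%C * rot_s theta.
Proof. by rewrite /expi rmorphD rmorphM /= conj_im conj_rot_c conj_rot_s mulNr.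
  Qed.

Lemma expiJK (theta : R) : (expi theta)^* * expi theta = 1.
Proof. by rewrite mulrC -sqr_normcE normc_expi expr1n. Qed.

Lemma cay_rotmx_expi (theta : R) :
  cay (rotmx d theta) = (expi theta)^* *: sblock d (expi theta ^+ 2) 0 0 1.
Proof.
rewrite cay_rotmx -expiJ scale_sblock mulr1 mulr0 expr2 mulrA expiJK mul1r.
by [].
Qed.

Lemma cay_rotprod theta s : cay (rotprod theta s) =
  (expi theta)^* ^+ size s *: zprod (expi theta ^+ 2) s.
Proof.
rewrite /rotprod /zprod; elim: s => [|T s IH].
  by rewrite !big_nil cay1 scale1r.
have scaleM (a b : C) (X K Y : M2) :
    a *: X *m K *m (b *: Y) = (a * b) *: (X *m K *m Y).
  by rewrite -scalemxAr -!scalemxAl scalerA mulrC.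
by rewrite !big_cons !cayM IH cay_rotmx_expi scaleM -exprS.
Qed.

Lemma drsubmxZ (k : C) T : drsubmx (k *: T) = k *: drsubmx T.
Proof. by apply/matrixP => i j; rewrite !mxE. Qed.

Lemma Nsum_rotprod theta s : hsp_seq s ->
  Nsum d (rotprod theta s) =
  ln (normc (\det (drsubmx (zprod (expi theta ^+ 2) s)))).
Proof.
move=> sH; rewrite Nsum_ln_det; last exact: HSp_rotprod.
rewrite cay_rotprod drsubmxZ detZ normcM.
suff -> : normc (((expi theta)^* ^+ size s) ^+ d) = 1 by rewrite mul1r.
have nX (z : C) n : normc z = 1 -> normc (z ^+ n) = 1.
  by move=> z1; elim: n => [|n IH]; rewrite ?normc1// exprS normcM z1 IH mulr1.
by apply/nX/nX; rewrite normc_conj normc_expi.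
Qed.

(** [zprod] with an indeterminate for [z]; its minors are polynomials by construction. *)
Definition zprod_poly s : 'M[{poly C}]_(d + d) :=
  \big[mulmx/1%:M]_(T <- s)
    (block_mx ('X%:M) 0 0 1%:M *m map_mx (@polyC C) (cay T)).

Lemma zprod_polyE z s : map_mx (horner_eval z) (zprod_poly s) = zprod z s.
Proof.
rewrite /zprod_poly /zprod; elim: s => [|T s IH].
  by rewrite !big_nil map_mx1.
rewrite !big_cons !map_mxM IH; congr (_ *m _ *m _).
  rewrite map_block_mx !map_scalar_mx !map_mx0 /= rmorph1 /horner_eval hornerX.
  by rewrite /sblock raddf0.
by apply/matrixP => i j; rewrite !mxE /= /horner_eval hornerC.
Qed.

Definition ddet_poly s : {poly C} := \det (drsubmx (zprod_poly s)).

Lemma ddet_polyE z s : (ddet_poly s).[z] = \det (drsubmx (zprod z s)).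
Proof.
rewrite -zprod_polyE -map_drsubmx det_map_mx; by [].
Qed.

Definition sgnform (v : 'cV[C]_(d + d)) : R :=
  frob2 (usubmx v) - frob2 (dsubmx v).

Lemma sgnformE v : (sgnform v)%:C%C = \tr (v ^t* *m sgnG R d *m v).
Proof.
rewrite /sgnform rmorphB /= !frob2E -[in RHS](vsubmxK v).
rewrite tr_col_mx map_row_mx /sgnG /sblock raddf0 raddfN mul_row_block
  mul_row_col.
by rewrite !mulmx0 mulmx1 mulmxN mulmx1 addr0 add0r mulNmx raddfB.
Qed.

Lemma sgnform_cay T v : HSp T -> sgnform (cay T *m v) = sgnform v.
Proof.
move=> TH; apply: (@complexI R); rewrite !sgnformE adjM.
by rewrite -{2}(cay_HSp TH) !mulmxA.
Qed.

Lemma frob2Z m n (z : C) (M : 'M[C]_(m, n)) : frob2 (z *: M) =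
  normc z ^+ 2 * frob2 M.
Proof.
rewrite /frob2 mulr_sumr; apply: eq_bigr => i _.
by rewrite mulr_sumr; apply: eq_bigr => j _; rewrite mxE normcM exprMn.
Qed.

Lemma sgnform_zblock z v : normc z <= 1 ->
  sgnform (sblock d z 0 0 1 *m v) <= sgnform v.
Proof.
move=> z1; rewrite /sgnform -{1 2}(vsubmxK v) /sblock raddf0 mul_block_col.
rewrite !mul0mx addr0 add0r col_mxKu col_mxKd mul1mx mul_scalar_mx frob2Z.
rewrite lerB// ler_piMl ?frob2_ge0//.
by rewrite expr_le1// normc_ge0.
Qed.

Lemma sgnform_zprod z s v : hsp_seq s -> normc z <= 1 ->
  sgnform (zprod z s *m v) <= sgnform v.
Proof.
rewrite /zprod => + z1; elim: s => [_|T s IH /hsp_seq_cons[TH sH]].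
  by rewrite big_nil mul1mx.
rewrite big_cons -!mulmxA; apply: le_trans (sgnform_zblock _ z1) _.
by rewrite sgnform_cay//; exact: IH.
Qed.

Lemma frob2_eq0 m n (M : 'M[C]_(m, n)) : frob2 M = 0 -> M = 0.
Proof.
move=> /eqP; rewrite psumr_eq0 => [/allP M0|i _]; last first.
  by apply: sumr_ge0 => j _; exact: sqr_ge0.
apply/matrixP => i j; rewrite mxE; have := M0 i (mem_index_enum _).
rewrite psumr_eq0 => [/allP /(_ j (mem_index_enum _))|k _]; last exact: sqr_ge0.
by rewrite sqrf_eq0 normc_eq0 => /eqP.
Qed.

(* [zprod z s] contracts the form [|v_+|^2 - |v_-|^2], so it maps no vector
   [(0, w)] to one of the form [(u, 0)]. *)
Lemma ddet_neq0 z s : hsp_seq s -> normc z <= 1 -> (ddet_poly s).[z] != 0.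
Proof.
move=> sH z1; rewrite ddet_polyE -det_tr; apply/negP => /det0P[w w0 wQ].
have Qw : drsubmx (zprod z s) *m w^T = 0.
  by apply: trmx_inj; rewrite trmx_mul trmxK wQ trmx0.
(* A kernel vector of the lower right block gives the input [(0, w)], whose form is [- |w|^2], and
   an output with zero lower half, whose form is nonnegative. Hence [w = 0]. *)
have := sgnform_zprod (col_mx 0 w^T) sH z1.
rewrite -{1}(submxK (zprod z s)) mul_block_col !mulmx0 !add0r Qw.
rewrite /sgnform !col_mxKu !col_mxKd.
have -> : frob2 (0 : 'cV[C]_d) = 0.
  by rewrite -(scale0r (0 : 'cV[C]_d)) frob2Z [normc 0]ComplexField.Normc.normc0
    expr0n mul0r.
rewrite subr0 add0r => le.
have /frob2_eq0 /(congr1 trmx) : frob2 (w^T) = 0.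
  apply/le_anti; rewrite frob2_ge0 andbT -oppr_ge0.
  by apply: le_trans le; exact: frob2_ge0.
by rewrite trmxK trmx0 => /eqP; rewrite (negPf w0).
Qed.

(** At [z = 0] every factor has a zero upper block row, so the product is block lower triangular and
    the lower right blocks simply multiply. *)
Lemma ddet_poly0 s : (ddet_poly s).[0] = \prod_(T <- s) \det (drsubmx (cay T)).
Proof.
rewrite ddet_polyE /zprod.
suff [_ ->] : ursubmx (\big[mulmx/1%:M]_(T <- s) (sblock d 0 0 0 1 *m cay T)) =
  0 /\
  \det (drsubmx (\big[mulmx/1%:M]_(T <- s) (sblock d 0 0 0 1 *m cay T))) =
   \prod_(T <- s) \det (drsubmx (cay T)) by [].
elim: s => [|T s [IHu IHd]].
  by rewrite !big_nil -(sblock1 R d) /sblock block_mxKur block_mxKdr raddf0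
    det1.
rewrite !big_cons -IHd; move: IHu; set X := \big[_/_]_(_ <- _) _ => IHu.
have -> : sblock d 0 0 0 1 *m cay T *m X = block_mx 0 0
   (dlsubmx (cay T) *m ulsubmx X + drsubmx (cay T) *m dlsubmx X)
   (drsubmx (cay T) *m drsubmx X).
  rewrite -{1}(submxK (cay T)) -{1}(submxK X) IHu /sblock raddf0.
  by rewrite !mulmx_block !(mul0mx, mul1mx, mulmx0, add0r, addr0).
by rewrite block_mxKur block_mxKdr det_mulmx.
Qed.

(** The absence of zeros in the disc, for a single factor at [z = 0]. *)
Lemma det_drsubmx_cay_neq0 T : HSp T -> \det (drsubmx (cay T)) != 0.
Proof.
move=> TH; have TsH : hsp_seq [:: T] by move=> T'; rewrite inE => /eqP ->.
have := @ddet_neq0 0 [:: T] TsH; rewrite ddet_poly0 big_seq1; apply.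
by rewrite [X in X <= _]ComplexField.Normc.normc0.
Qed.

Lemma sum_Nsum s : hsp_seq s ->
  \sum_(T <- s) Nsum d T = ln (normc (\prod_(T <- s) \det (drsubmx (cay T)))).
Proof.
move=> sH; suff [-> //] : \sum_(T <- s) Nsum d T =
  ln (normc (\prod_(T <- s) \det (drsubmx (cay T)))) /\
  \prod_(T <- s) \det (drsubmx (cay T)) != 0.
elim: s sH => [_|T s IH /hsp_seq_cons[TH sH]].
  by rewrite !big_nil normc1 ln1 oner_eq0.
have [IHs IH0] := IH sH; have T0 := det_drsubmx_cay_neq0 TH.
rewrite !big_cons IHs Nsum_ln_det// normcM lnM ?posrE ?normc_gt0//.
by rewrite mulf_neq0.
Qed.

Lemma continuous_Nsum_rotprod s : hsp_seq s ->
  continuous (fun theta => Nsum d (rotprod theta s)).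
Proof.
move=> sH; have [cq _] := Jensen_poly (fun z => @ddet_neq0 z s sH).
under eq_fun do rewrite Nsum_rotprod// -ddet_polyE.
exact: cq.
Qed.

Theorem integral_Nsum_rotprod s : hsp_seq s ->
  (\int[mu]_(theta in `[0%R, 1%R]) (Nsum d (rotprod theta s))%:E =
   (\sum_(T <- s) Nsum d T)%:E)%E.
Proof.
move=> sH; have [_ Iq] := Jensen_poly (fun z => @ddet_neq0 z s sH).
under eq_integral do rewrite Nsum_rotprod// -ddet_polyE.
by rewrite Iq ddet_poly0 sum_Nsum.
Qed.

End RotatedProducts.

(** * Gelfand's formula *)

Section Gelfand.
Variables (R : realType) (m : nat).
Local Notation C := R[i].
Implicit Types M L : 'M[C]_m.
Hypothesis m0 : (0 < m)%N.

Lemma normcX (z : C) n : normc (z ^+ n) = normc z ^+ n.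
Proof. by elim: n => [|n IH]; rewrite ?expr0 ?normc1// !exprS normcM IH. Qed.

Lemma frob2_gt0 p q (M : 'M[C]_(p, q)) : M != 0 -> 0 < frob2 M.
Proof.
move=> M0; rewrite lt_neqAle frob2_ge0 andbT eq_sym.
by apply: contra M0 => /eqP /frob2_eq0 ->.
Qed.

Lemma eigenvalue_frob2 M z n : eigenvalue M z ->
  normc z ^+ (2 * n) <= frob2 (M ^+ n).
Proof.
move=> /eigenvalueP[v vM v0].
have vMn : v *m (M ^+ n) = z ^+ n *: v.
  elim: n => [|n IH]; first by rewrite expr0 scale1r mulmx1.
  by rewrite exprSr -mulmxE mulmxA IH -scalemxAl vM scalerA -exprSr.
have := frob2M v (M ^+ n); rewrite vMn frob2Z normcX -exprM (mulnC n).
by rewrite mulrC ler_pM2l// frob2_gt0.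
Qed.

Lemma eigenvalue_le_specrad M z : eigenvalue M z -> normc z <= specrad M.
Proof.
move=> Mz; apply: ub_le_sup; last by exists z.
exists (Num.sqrt (frob2 M)) => _ [y /= My <-].
have := eigenvalue_frob2 1 My; rewrite expr1 muln1 => le.
by rewrite -(ler_pXn2r (ltn0Sn 1)) ?nnegrE ?normc_ge0 ?sqrtr_ge0// sqr_sqrtr//
  frob2_ge0.
Qed.

Lemma specrad_frob2 M n : specrad M ^+ (2 * n) <= frob2 (M ^+ n).
Proof.
have [z0 Mz0] := eigenvalue_closed M m0.
case: n => [|n].
  by rewrite muln0; have := eigenvalue_frob2 0 Mz0; rewrite muln0.
have f0 : 0 <= frob2 (M ^+ n.+1) := frob2_ge0 _.
(* Taking the root turns the bound on each eigenvalue into an upper bound of the set whose supremum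
   is [specrad M]. *)
set r := powR (frob2 (M ^+ n.+1)) (2 * n.+1)%:R^-1.
have rE : r ^+ (2 * n.+1) = frob2 (M ^+ n.+1).
  by rewrite -powR_mulrn ?powR_ge0// /r -powRrM mulVf ?powRr1// pnatr_eq0.
rewrite -rE; have s0 : 0 <= specrad M.
  exact: le_trans (normc_ge0 _) (eigenvalue_le_specrad Mz0).
rewrite lerXn2r// ?nnegrE ?powR_ge0//.
apply: sup_le_ub; first by exists (normc z0); exists z0.
move=> _ [z /= Mz <-].
rewrite -(@ler_pXn2r _ (2 * n.+1)) ?nnegrE ?normc_ge0 ?powR_ge0//.
by rewrite rE; exact: eigenvalue_frob2.
Qed.

Lemma specrad_gt0 M : M \in unitmx -> 0 < specrad M.
Proof.
move=> Mu; have [z Mz] := eigenvalue_closed M m0.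
apply: lt_le_trans (eigenvalue_le_specrad Mz).
rewrite normc_gt0; apply/eqP => z0; have /eigenvalueP[v vM v0] := Mz.
by move: v0; rewrite -(mulmxK Mu v) vM z0 scale0r mul0mx eqxx.
Qed.

(* Weighting the [j]-th coordinate by [u ^+ j] with [u] large makes the
   off-diagonal part of [L] negligible. *)
Lemma trig_pow_bound L (rho eps : R) : is_trig_mx L -> 0 <= rho -> 0 < eps ->
  (forall i, normc (L i i) <= rho) ->
  exists2 u, 1 <= u & forall n i,
    \sum_j normc ((L ^+ n) i j) * u ^+ j <= (rho + eps) ^+ n * u ^+ i.
Proof.
move=> Ltrig rho0 eps0 Lii.
pose c := \sum_i \sum_j normc (L i j).
have Lc i j : normc (L i j) <= c.
  rewrite /c (bigD1 i)//= (bigD1 j)//= -addrA lerDl addr_ge0//.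
    by apply: sumr_ge0 => k _; exact: normc_ge0.
  by apply: sumr_ge0 => k _; apply: sumr_ge0 => l _; exact: normc_ge0.
have c0 : 0 <= c by apply: sumr_ge0 => k _; apply: sumr_ge0 => l _;
  exact: normc_ge0.
(* Chosen so that [m%:R * c <= eps * u]. The off-diagonal entries of row [i] are zero outside the
   columns [k < i], where [u ^+ k <= u ^+ i / u]; together they contribute at most
   [eps * u ^+ i]. *)
pose u := 1 + m%:R * c / eps.
have mc0 : 0 <= m%:R * c / eps by rewrite divr_ge0 ?mulr_ge0// ltW.
have u1 : 1 <= u by rewrite lerDl.
have u0 : 0 < u by rewrite (lt_le_trans ltr01).
have ueps : m%:R * c <= eps * u.
  by rewrite mulrDr mulr1 mulrCA mulfV ?gt_eqF// mulr1 lerDr ltW.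
exists u => // n i; elim: n i => [|n IH] i.
  rewrite expr0 mul1r (bigD1 i)//= big1 ?addr0.
    by rewrite mxE eqxx normc1 mul1r.
  move=> j ji; rewrite mxE eq_sym (negPf ji).
  by rewrite [normc _]ComplexField.Normc.normc0 mul0r.
have r0 : 0 <= (rho + eps) ^+ n by rewrite exprn_ge0// addr_ge0// ltW.
apply: (@le_trans _ _ (\sum_k normc (L i k) * ((rho + eps) ^+ n * u ^+ k))).
  apply: (@le_trans _ _
    (\sum_j (\sum_k normc (L i k) * normc ((L ^+ n) k j)) * u ^+ j)).
    apply: ler_sum => j _; rewrite ler_wpM2r ?exprn_ge0 ?(ltW u0)//.
    rewrite exprS -mulmxE mxE; apply: le_trans (normc_sum _) _.
    by apply: ler_sum => k _; rewrite normcM.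
  under eq_bigr do rewrite mulr_suml.
  rewrite exchange_big /=; apply: ler_sum => k _.
  under eq_bigr do rewrite -mulrA.
  by rewrite -mulr_sumr ler_wpM2l ?normc_ge0.
rewrite (eq_bigr (fun k => (rho + eps) ^+ n * (normc (L i k) * u ^+ k)));
  last first.
  by move=> k _; rewrite mulrCA.
rewrite -mulr_sumr exprSr -mulrA ler_wpM2l// mulrDl (bigD1 i)//=.
apply: lerD; first by rewrite ler_wpM2r ?exprn_ge0 ?(ltW u0).
apply: (@le_trans _ _ (\sum_(k < m | k != i) c * (u ^+ i / u))).
  apply: ler_sum => k ki; have [ik|ik] := ltnP i k.
    rewrite (is_trig_mxP Ltrig)// [X in X * _]ComplexField.Normc.normc0 mul0r.
    by rewrite mulr_ge0// divr_ge0 ?exprn_ge0 ?(ltW u0).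
  have {}ik : (k < i)%N by rewrite ltn_neqAle ki.
  apply: ler_pM; rewrite ?normc_ge0 ?exprn_ge0 ?(ltW u0)//.
  rewrite ler_pdivlMr// -exprSr; exact: ler_weXn2l.
apply: (@le_trans _ _ (m%:R * (c * (u ^+ i / u)))).
  rewrite -[X in _ <= X%:R * _]card_ord mulr_natl -sumr_const.
  rewrite [leRHS](bigID (fun k => k != i))/= lerDl; apply: sumr_ge0 => k _.
  by rewrite mulr_ge0// divr_ge0 ?exprn_ge0 ?(ltW u0).
rewrite mulrCA mulrA mulrC -mulrA [in leRHS]mulrC ler_wpM2l ?exprn_ge0
  ?(ltW u0)//.
rewrite mulrC ler_pdivrMr// mulrC; exact: ueps.
Qed.

(** Schur's triangular form has the eigenvalues on its diagonal, so [trig_pow_bound] applies with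
    [rho = specrad M]. Undoing the weights and the unitary conjugation costs a factor independent of
    [n]. *)
Lemma frob2_pow_bound M (eps : R) : 0 < eps ->
  exists2 K, 0 < K & forall n, frob2 (M ^+ n) <=
    K * (specrad M + eps) ^+ (2 * n).
Proof.
move=> eps0; have [P Pu] := Schur M m0.
rewrite /similar_to /= conjymx// => Ltrig.
set L := P *m M *m P ^t* in Ltrig.
have P1 : P ^t* *m P = 1%:M by exact/mulmx1C/unitarymxP.
have ML : M = P ^t* *m L *m P.
  by rewrite /L !mulmxA P1 mul1mx -mulmxA P1 mulmx1.
clearbody L.
have [z0 Mz0] := eigenvalue_closed M m0.
have s0 : 0 <= specrad M.
  exact: le_trans (normc_ge0 _) (eigenvalue_le_specrad Mz0).
have Lii i : normc (L i i) <= specrad M.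
  apply: eigenvalue_le_specrad; rewrite eigenvalue_root_char ML.
  rewrite char_poly_unitary// char_poly_trig// (bigD1 i)//= rootM.
  by rewrite root_XsubC eqxx.
have [u u1 uL] := trig_pow_bound Ltrig s0 eps0 Lii.
have u0 : 0 < u by rewrite (lt_le_trans ltr01).
have Mn n : M ^+ n = P ^t* *m (L ^+ n) *m P.
  elim: n => [|n IH]; first by rewrite mulmx1 P1.
  rewrite exprS -mulmxE IH {1}ML -!mulmxA (mulmxA P (P ^t*)) (unitarymxP Pu)
    mul1mx.
  by rewrite (mulmxA L) mulmxE -exprS.
pose K0 := m%:R ^+ 2 * (u ^+ m) ^+ 2.
have Ln n : frob2 (L ^+ n) <= K0 * (specrad M + eps) ^+ (2 * n).
  have r0 : 0 <= (specrad M + eps) ^+ n by rewrite exprn_ge0// addr_ge0// ltW.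
  have Lij i j : normc ((L ^+ n) i j) ^+ 2 <=
    (u ^+ m) ^+ 2 * (specrad M + eps) ^+ (2 * n).
    rewrite mulnC exprM -exprMn lerXn2r// ?nnegrE ?normc_ge0 ?mulr_ge0
      ?exprn_ge0 ?(ltW u0)//.
      by rewrite addr_ge0// ltW.
    apply: (@le_trans _ _ (\sum_j normc ((L ^+ n) i j) * u ^+ j)).
      rewrite (bigD1 j)//= ler_wpDr//.
        by apply: sumr_ge0 => k _;
          rewrite mulr_ge0 ?normc_ge0// exprn_ge0// ltW.
      by rewrite ler_peMr ?normc_ge0// exprn_ege1.
    apply: le_trans (uL n i) _; rewrite mulrC ler_wpM2r//.
    by apply: ler_weXn2l => //; exact: ltnW (ltn_ord i).
  rewrite /frob2; apply: (@le_trans _ _ (\sum_(i < m) \sum_(j < m)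
     (u ^+ m) ^+ 2 * (specrad M + eps) ^+ (2 * n))).
    by apply: ler_sum => i _; apply: ler_sum => j _; exact: Lij.
  rewrite !sumr_const card_ord -mulrnA -mulr_natl natrM /K0 expr2 !mulrA lexx//.
exists (frob2 (P ^t*) * frob2 P * K0 + 1).
  by rewrite ltr_wpDl// /K0 !mulr_ge0 ?frob2_ge0 ?exprn_ge0// ltW.
move=> n; rewrite Mn mulrDl mul1r ler_wpDr//.
  by rewrite exprn_ge0// addr_ge0// ltW.
apply: le_trans (frob2M _ _) _.
rewrite -(mulrA _ K0) (mulrAC _ (frob2 P)) ler_wpM2r ?frob2_ge0//.
by apply: le_trans (frob2M _ _) _; rewrite ler_wpM2l ?frob2_ge0.
Qed.

(** Eigenvalues bound the norms of powers from below, [frob2_pow_bound] bounds them from above.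
    Invertibility makes [specrad M] positive, so that its logarithm is meaningful. *)
Lemma Gelfand M : M \in unitmx ->
  (2 * n.+1)%:R^-1 * ln (frob2 (M ^+ n.+1)) @[n --> \oo] --> ln (specrad M).
Proof.
move=> Mu; have s0 := specrad_gt0 Mu.
have Mn0 n : 0 < frob2 (M ^+ n.+1).
  by apply: lt_le_trans (specrad_frob2 _ _); rewrite exprn_gt0.
apply/cvgrPdist_le => e e0.
(* Makes [specrad M + eps] equal to [specrad M * expR (e / 2)]: half of [e] is spent here, the other
   half on the constant [K]. *)
pose eps := specrad M * (expR (e / 2) - 1).
have eps0 : 0 < eps by rewrite mulr_gt0// subr_gt0 expR_gt1 divr_gt0.
have [K K0 MK] := frob2_pow_bound M eps0.
have sE : specrad M + eps = specrad M * expR (e / 2).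
  by rewrite /eps mulrBr mulr1 addrC subrK.
have lim0 : (2 * n.+1)%:R^-1 * ln K @[n --> \oo] --> (0 : R).
  rewrite -(mul0r (ln K)); apply: cvgMl.
  under eq_fun do rewrite natrM invfM.
  rewrite -(mulr0 2^-1); apply: cvgMr; exact: cvg_harmonic.
have /cvgrPdist_le /(_ (e / 2)) := lim0; rewrite divr_gt0// => /(_ isT) nearK.
near=> n; have n0 : 0 < (2 * n.+1)%:R :> R by rewrite ltr0n.
have lo : ln (specrad M) <= (2 * n.+1)%:R^-1 * ln (frob2 (M ^+ n.+1)).
  rewrite ler_pdivlMl// mulr_natl -lnXn// ler_ln ?posrE ?exprn_gt0//.
  exact: specrad_frob2.
have hi : (2 * n.+1)%:R^-1 * ln (frob2 (M ^+ n.+1)) <= ln (specrad M) + e.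
  apply: (@le_trans _ _ ((2 * n.+1)%:R^-1 * ln K + ln (specrad M + eps))).
    rewrite -[X in _ <= _ + X](mulKf (lt0r_neq0 n0)) -mulrDr ler_pM2l
      ?invr_gt0//.
    have sp : 0 < specrad M + eps by rewrite addr_gt0.
    rewrite mulr_natl -lnXn// -lnM ?posrE ?exprn_gt0//.
    by rewrite ler_ln ?posrE ?mulr_gt0 ?exprn_gt0.
  rewrite sE lnM ?posrE ?expR_gt0// expRK addrCA lerD2l.
  rewrite [leRHS](splitr e) lerD2r.
  have := (near nearK n _); rewrite sub0r normrN => h;
    apply: le_trans (ler_norm _) (h _).
  by [].
by rewrite distrC ger0_norm ?subr_ge0// lerBlDl.
Unshelve. all: by end_near. Qed.

End Gelfand.

(** * Spectral radius of rotated products *)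

Section SymplecticBounds.
Variables (R : realType) (d : nat).
Notation mu := (@lebesgue_measure R).
Local Notation C := R[i].
Local Notation M2 := 'M[C]_(d + d).
Implicit Types (T : M2) (s : seq M2).

Lemma HSp_sigprod2_ge1 T k : HSp T -> (k <= d)%N -> 1 <= sigprod2 k T.
Proof.
move=> TH kd; apply: (@le_trans _ _ (\prod_(i < k) 1)); first by rewrite big1.
apply: ler_prod => i _; rewrite ler01 /=.
by rewrite exprn_ege1// HSp_singval_ge1// (leq_trans _ kd).
Qed.

Lemma sigprod2_le_extfrob2 T k : (k <= d)%N -> sigprod2 k T <= extfrob2 k T.
Proof.
move=> kd; have kdd : (k <= d + d)%N by rewrite (leq_trans kd) ?leq_addr.
by have /andP[] := extfrob2_sigprod2 T kdd.
Qed.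

Lemma HSp_extfrob2_ge1 T k : HSp T -> (k <= d)%N -> 1 <= extfrob2 k T.
Proof.
by move=> TH kd; apply: le_trans (sigprod2_le_extfrob2 _ kd);
  exact: HSp_sigprod2_ge1.
Qed.

Lemma card_ltn_tuples_gt0 k m : (k <= m)%N -> (0 < #|ltn_tuples k m|)%N.
Proof.
move=> km; apply/card_gt0P; exists [tuple widen_ord km i | i < k].
exact: widen_ltn_tuples.
Qed.

Lemma HSp_ln_extfrob2_sigprod2 T k : HSp T -> (k <= d)%N ->
  ln (sigprod2 k T) <= ln (extfrob2 k T)
    <= ln #|ltn_tuples k (d + d)|%:R + ln (sigprod2 k T).
Proof.
move=> TH kd; have kdd : (k <= d + d)%N by rewrite (leq_trans kd) ?leq_addr.
have s1 := HSp_sigprod2_ge1 TH kd; have f1 := HSp_extfrob2_ge1 TH kd.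
have s0 : 0 < sigprod2 k T by rewrite (lt_le_trans ltr01).
have f0 : 0 < extfrob2 k T by rewrite (lt_le_trans ltr01).
have c0 : 0 < #|ltn_tuples k (d + d)|%:R :> R
  by rewrite ltr0n card_ltn_tuples_gt0.
have /andP[lo hi] := extfrob2_sigprod2 T kdd.
by rewrite -lnM// !ler_ln ?posrE ?mulr_gt0// lo hi.
Qed.

(** For [s >= 1] one has [(s + s^-1) / 2 <= s <= s + s^-1]; the second inequality costs [ln 2] per
    singular value. *)
Lemma HSp_sigprod2_Nsum T : HSp T ->
  Nsum d T <= 2^-1 * ln (sigprod2 d T) <= Nsum d T + d%:R * ln 2.
Proof.
move=> TH; have s1 (i : 'I_d) : 1 <= singval T i :=
  HSp_singval_ge1 TH (ltn_ord i).
have s0 (i : 'I_d) : 0 < singval T i := lt_le_trans ltr01 (s1 i).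
have is0 (i : 'I_d) : 0 < (singval T i)^-1 by rewrite invr_gt0.
have -> : 2^-1 * ln (sigprod2 d T) = \sum_(i < d) ln (singval T i).
  rewrite /sigprod2 -ln_prod_gt0 => [|i]; last by rewrite exprn_gt0.
  rewrite mulr_sumr; apply: eq_bigr => i _.
  by rewrite lnXn// -(mulr_natl (ln _)) mulKf// pnatr_eq0.
have -> : Nsum d T + d%:R * ln 2 =
    \sum_(i < d) (ln ((singval T i + (singval T i)^-1) / 2) + ln 2).
  by rewrite big_split /= sumr_const card_ord mulr_natl.
have si1 (i : 'I_d) : (singval T i)^-1 <= 1 by rewrite invf_le1.
apply/andP; split; apply: ler_sum => i _.
  rewrite ler_ln ?posrE ?divr_gt0 ?addr_gt0//.
  rewrite ler_pdivrMr// mulr_natr mulr2n lerD2l.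
  exact: le_trans (si1 i) (s1 i).
rewrite -lnM ?posrE ?divr_gt0 ?addr_gt0// divfK// ler_ln ?posrE ?addr_gt0//.
by rewrite lerDl ltW.
Qed.

Lemma HSp_Nsum_ge0 T : HSp T -> 0 <= Nsum d T.
Proof.
move=> TH; apply: sumr_ge0 => i _; apply: ln_ge0.
have s1 := HSp_singval_ge1 TH (ltn_ord i).
have s0 := lt_le_trans ltr01 s1.
rewrite ler_pdivlMr// mul1r -subr_ge0.
have -> : singval T i + (singval T i)^-1 - 2 =
  (singval T i - 1) ^+ 2 / singval T i.
  by field; rewrite gt_eqF.
by rewrite divr_ge0 ?sqr_ge0// ltW.
Qed.

Lemma HSp_ln_extfrob2M T T' k : HSp T -> HSp T' -> (k <= d)%N ->
  ln (extfrob2 k (T *m T')) <= ln (extfrob2 k T) + ln (extfrob2 k T').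
Proof.
move=> TH TH' kd.
have f0 S : HSp S -> 0 < extfrob2 k (S : M2).
  by move=> SH; rewrite (lt_le_trans ltr01)// HSp_extfrob2_ge1.
rewrite -lnM ?posrE ?f0// ler_ln ?posrE ?mulr_gt0 ?f0//; last exact: HSpM.
exact: extfrob2M.
Qed.

(** The Hilbert-Schmidt norm of the identity is not 1 in general: hence the additive constant in
    bounds that start from an empty product, and the nonempty sequence in [ln_extfrob2_rotprod]. *)
Lemma ln_extfrob2_1 k : ln (extfrob2 k (1%:M : M2)) =
  ln #|ltn_tuples k (d + d)|%:R.
Proof.
congr ln; apply: (@complexI R); rewrite extfrob2E trmx1 map_mx1 mul1mx extpow1.
by rewrite mxtrace1 rmorph_nat.
Qed.

Lemma extfrob2_rot k theta T : extfrob2 k (rotmx d theta *m T) = extfrob2 k T.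
Proof. exact/extfrob2_isom/rotmx_unitary. Qed.

Lemma ln_extfrob2_rotprod k theta s : (k <= d)%N -> hsp_seq s ->
  (0 < size s)%N ->
  ln (extfrob2 k (rotprod theta s)) <= \sum_(T <- s) ln (extfrob2 k T).
Proof.
move=> kd; rewrite /rotprod; elim: s => // T [|T' s] IH /hsp_seq_cons[TH sH] _.
  by rewrite !big_cons !big_nil mulmx1 addr0 extfrob2_rot.
rewrite big_cons [leRHS]big_cons; apply: le_trans (HSp_ln_extfrob2M _ _ kd) _.
- by apply: HSpM => //; exact: HSp_rotmx.
- exact: HSp_rotprod.
by rewrite extfrob2_rot lerD2l; exact: IH.
Qed.

(** The right side is free of [theta]; it provides the domination in both passages to the limit
    under the angular average. *)
Lemma Nsum_rotprod_le theta s : hsp_seq s -> (0 < size s)%N ->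
  Nsum d (rotprod theta s) <= 2^-1 * \sum_(T <- s) ln (extfrob2 d T).
Proof.
move=> sH s0; have PH := HSp_rotprod theta sH.
have /andP[le _] := HSp_sigprod2_Nsum PH; apply: (le_trans le).
rewrite ler_pM2l ?invr_gt0//;
  apply: le_trans (ln_extfrob2_rotprod theta (leqnn d) sH s0).
by have /andP[] := HSp_ln_extfrob2_sigprod2 PH (leqnn d).
Qed.

Lemma rotprod_cat theta s s' :
  rotprod theta (s ++ s') = rotprod theta s *m rotprod theta s'.
Proof.
rewrite /rotprod; elim: s => [|T s IH]; first by rewrite big_nil mul1mx.
by rewrite /= !big_cons IH !mulmxA.
Qed.

Lemma rotprod_flatten_nseq theta s n :
  rotprod theta (flatten (nseq n s)) = (rotprod theta s) ^+ n.
Proof.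
elim: n => [|n IH]; first by rewrite /rotprod big_nil.
by rewrite /= rotprod_cat IH exprS mulmxE.
Qed.

Lemma extpowX k T n : extpow k (T ^+ n) = (extpow k T) ^+ n.
Proof.
by elim: n => [|n IH]; [exact: extpow1|rewrite !exprS -!mulmxE extpowM IH].
Qed.

Lemma extpow_unit k T : T \in unitmx -> extpow k T \in unitmx.
Proof.
move=> Tu; have /mulmx1_unit[] // : extpow k T *m extpow k (invmx T) = 1%:M.
by rewrite -extpowM mulmxV// extpow1.
Qed.

Lemma HSp_unit T : HSp T -> T \in unitmx.
Proof. by move=> /HSp_mulKl /mulmx1_unit[]. Qed.

Lemma HSpX T n : HSp T -> HSp (T ^+ n : M2).
Proof.
by move=> TH; elim: n => [|n IH];
  [exact: HSp1|rewrite exprS -mulmxE; exact: HSpM].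
Qed.

(* Up to a bounded error, [Nsum d] is the logarithm of the norm of the
   exterior power, so Gelfand's formula computes the spectral radius. *)
Lemma cvg_Nsum_specrad T : HSp T ->
  n.+1%:R^-1 * Nsum d (T ^+ n.+1) @[n --> \oo] --> ln (specrad (extpow d T)).
Proof.
move=> TH; have dd : (d <= d + d)%N by rewrite leq_addr.
have := Gelfand (card_ltn_tuples_gt0 dd) (extpow_unit d (HSp_unit TH)).
set l := ln _ => gl.
(* Sum of two errors: Hilbert-Schmidt against operator norm of the exterior power, and [sigprod2]
   against [Nsum]. *)
pose c : R := 2^-1 * ln #|ltn_tuples d (d + d)|%:R + d%:R * ln 2.
have c0 : 0 <= c.
  rewrite addr_ge0 ?mulr_ge0 ?ln_ge0 ?ler1n ?card_ltn_tuples_gt0//.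
have cl : n.+1%:R^-1 * c @[n --> \oo] --> (0 : R).
  by rewrite -(mul0r c); apply: cvgMl; exact: cvg_harmonic.
have lo : (2 * n.+1)%:R^-1 * ln (frob2 (extpow d T ^+ n.+1)) - n.+1%:R^-1 * c
    @[n --> \oo] --> l by rewrite -[l]subr0; apply: cvgB.
apply: (squeeze_cvgr _ lo gl); apply: nearW => n.
have TnH := HSpX n.+1 TH.
have /andP[a1 a2] := HSp_sigprod2_Nsum TnH.
have /andP[b1 b2] := HSp_ln_extfrob2_sigprod2 TnH (leqnn d).
rewrite -extpowX natrM invfM -/(extfrob2 d _) [2^-1 * _]mulrC -mulrA -mulrBr.
have n0 : 0 < n.+1%:R^-1 :> R by rewrite invr_gt0.
rewrite !ler_pM2l//; apply/andP; split.
  rewrite lerBlDr; apply: le_trans (_ : 2^-1 * (ln #|ltn_tuples d (d + d)|%:R +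
     ln (sigprod2 d (T ^+ n.+1))) <= _); first by rewrite ler_pM2l ?invr_gt0.
  by rewrite /c mulrDr; lra.
by apply: le_trans a1 _; rewrite ler_pM2l ?invr_gt0.
Qed.

(** The first formula for [n.+1] concatenated copies of [s] shows that the averages of [f n] do not
    depend on [n], so their limit is known at once. *)
Theorem integral_ln_specrad_rotprod s : hsp_seq s -> (0 < size s)%N ->
  (\int[mu]_(theta in `[0%R, 1%R])
    (ln (specrad (extpow d (rotprod theta s))))%:E =
   (\sum_(T <- s) Nsum d T)%:E)%E.
Proof.
move=> sH s0; pose sn n := flatten (nseq n.+1 s).
have snH n : hsp_seq (sn n).
  by move=> T /flattenP[s' /nseqP[-> _]]; exact: sH.
pose f n theta := n.+1%:R^-1 * Nsum d (rotprod theta (sn n)).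
have cf n : continuous (f n).
  move=> x; apply: cvgM; first exact: cvg_cst.
  exact: (continuous_Nsum_rotprod (snH n)).
have sumsn n (F : M2 -> R) : \sum_(T <- sn n) F T = n.+1%:R * \sum_(T <- s) F T.
  rewrite /sn; elim: n => [|n IH]; first by rewrite /= cats0 mul1r.
  by rewrite [flatten _]/= big_cat /= IH [in RHS]mulrS mulrDl mul1r.
have int_f n : (\int[mu]_(theta in `[0%R, 1%R]) (f n theta)%:E =
    (\sum_(T <- s) Nsum d T)%:E)%E.
  under eq_integral do rewrite EFinM.
  rewrite integralZl//; last first.
    by apply: continuous_itv_integrable; exact: continuous_Nsum_rotprod.
  by rewrite integral_Nsum_rotprod// sumsn -EFinM mulrA mulVf// mul1r.
pose B := 2^-1 * \sum_(T <- s) ln (extfrob2 d T).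
have f_f theta : (f n theta)%:E @[n --> \oo] -->
  (ln (specrad (extpow d (rotprod theta s))))%:E.
  apply: cvg_EFin; first exact: nearW.
  have := cvg_Nsum_specrad (HSp_rotprod theta sH).
  apply: cvg_trans; apply: near_eq_cvg; apply: nearW => n /=.
  by rewrite /f /sn rotprod_flatten_nseq.
have dc : (\int[mu]_(x in `[0%R, 1%R]) (f n x)%:E)%E @[n --> \oo] -->
    (\int[mu]_(x in `[0%R, 1%R]) (ln (specrad (extpow d (rotprod x s))))%:E)%E.
  apply: (@dominated_cvg _ _ R mu _ _ _ _ (cst B%:E)) => //.
  - move=> n; apply/measurable_EFinP; apply: measurable_funTS.
    exact: continuous_measurable_fun.
  - by apply: continuous_itv_integrable; exact: cst_continuous.
  move=> n theta _; rewrite /= lee_fin ger0_norm.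
    rewrite /f; have sn0 : (0 < size (sn n))%N by rewrite size_cat addn_gt0 s0.
    rewrite ler_pdivrMl//; apply: le_trans (Nsum_rotprod_le _ (snH n) sn0) _.
    by rewrite sumsn mulrCA.
  by rewrite mulr_ge0 ?invr_ge0// HSp_Nsum_ge0//; exact: HSp_rotprod.
rewrite -(cvg_lim (@ereal_hausdorff R) dc).
under eq_fun do rewrite int_f.
exact: lim_cst.
Qed.

End SymplecticBounds.

(** * Fekete's lemma *)

Section Fekete.
Variable R : realType.

Lemma cvg_invn_cst (c : R) : n%:R^-1 * c @[n --> \oo] --> (0 : R).
Proof.
rewrite -(mul0r c); apply: cvgMl; apply/cvgrPdist_le => x x0.
near=> n; rewrite sub0r normrN ger0_norm ?invr_ge0//.
rewrite invf_ple ?posrE ?ltr0n//; last by near: n; exists 1%N.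
by near: n; exact: nbhs_infty_ger.
Unshelve. all: by end_near. Qed.

(** The limit is the infimum of [a n / n] over positive [n]. With a near-minimizer [p] and
    [n = q p + r], subadditivity bounds [a n] by [q] times [a p] plus one of finitely many
    remainders. *)
Lemma Fekete (a : nat -> R) : (forall n, 0 <= a n) ->
  (forall m n, a (m + n)%N <= a m + a n) ->
  exists l : R, n%:R^-1 * a n @[n --> \oo] --> l.
Proof.
move=> a0 asub; pose S := [set n.+1%:R^-1 * a n.+1 | n in [set: nat]].
have Slb : has_lbound S by exists 0 => _ [n _ <-]; rewrite mulr_ge0// invr_ge0.
have Sinf : has_inf S by split => //; exists (1%:R^-1 * a 1%N); exists 0%N.
exists (inf S); apply/cvgrPdist_le => e e0.
have [_ [p _ <-] plt] : exists2 x, S x & x < inf S + e / 2.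
  by apply: inf_adherent => //; rewrite divr_gt0.
(* The divisor is [p.+1]; as the terms are nonnegative, the full sum bounds each remainder [a r]. *)
pose K := \sum_(r < p.+1) a r.
have K0 : 0 <= K by apply: sumr_ge0.
have aq q r : a (q * p.+1 + r)%N <= q%:R * a p.+1 + a r.
  elim: q => [|q IH]; first by rewrite mul0n add0n mul0r add0r.
  by rewrite mulSn -addnA (le_trans (asub _ _))// mulrS mulrDl mul1r -addrA
    lerD2l.
have /cvgrPdist_le /(_ (e / 2)) := cvg_invn_cst K;
  rewrite divr_gt0// => /(_ isT) nearK.
near=> n.
have n_gt0 : (0 < n)%N by near: n; exists 1%N.
have n0 : 0 < n%:R :> R by rewrite ltr0n.
have lo : inf S <= n%:R^-1 * a n.
  by apply: ge_inf => //; exists n.-1 => //; rewrite prednK.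
have hi : n%:R^-1 * a n <= inf S + e.
  have nE : n = (n %/ p.+1 * p.+1 + n %% p.+1)%N := divn_eq n p.+1.
  have h1 : a n <= (n %/ p.+1)%:R * a p.+1 + K.
    rewrite {1}nE; apply: le_trans (aq _ _) _; rewrite lerD2l.
    have rp : (n %% p.+1 < p.+1)%N by rewrite ltn_mod.
    by rewrite /K (bigD1 (Ordinal rp))//= lerDl; apply: sumr_ge0.
  have h2 : (n %/ p.+1)%:R * a p.+1 <= n%:R * (p.+1%:R^-1 * a p.+1).
    rewrite mulrA ler_wpM2r// ler_pdivlMr ?ltr0n// -natrM ler_nat.
    exact: leq_trunc_div.
  have h3 : n%:R^-1 * K <= e / 2.
    have := near nearK n; rewrite sub0r normrN => h.
    by apply: le_trans (ler_norm _) (h _).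
  apply: (@le_trans _ _ (p.+1%:R^-1 * a p.+1 + n%:R^-1 * K)).
    rewrite ler_pdivrMl// mulrDr mulVKf ?gt_eqF//.
    by apply: le_trans h1 _; rewrite lerD2r.
  rewrite [in leRHS](splitr e) addrA; apply: lerD => //; exact: ltW.
by rewrite distrC ger0_norm ?subr_ge0// lerBlDl.
Unshelve. all: by end_near. Qed.

Lemma cvg_invn_close (a b : nat -> R) (c l : R) :
  (forall n, `|a n - b n| <= c) ->
  n%:R^-1 * a n @[n --> \oo] --> l -> n%:R^-1 * b n @[n --> \oo] --> l.
Proof.
move=> abc al.
have lo : n%:R^-1 * a n - n%:R^-1 * c @[n --> \oo] --> l.
  by rewrite -[l]subr0; apply: cvgB => //; exact: cvg_invn_cst.
have hi : n%:R^-1 * a n + n%:R^-1 * c @[n --> \oo] --> l.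
  by rewrite -[l]addr0; apply: cvgD => //; exact: cvg_invn_cst.
apply: (squeeze_cvgr _ lo hi); apply: nearW => n.
rewrite -mulrBr -mulrDr !ler_wpM2l ?invr_ge0//.
- by have := abc n; rewrite ler_norml => /andP[]; lra.
- by have := abc n; rewrite ler_norml => /andP[]; lra.
Qed.

End Fekete.

(** * Measurability *)

Section ComplexMeasurability.
Variables (R : realType) (dT : measure_display) (T : measurableType dT).
Local Notation C := R[i].
Implicit Types f g : T -> C.

Definition cmeas f :=
  measurable_fun setT (fun x => complex.Re (f x)) /\
  measurable_fun setT (fun x => complex.Im (f x)).

Lemma cmeas_cst z : cmeas (fun=> z).
Proof. by split; exact: measurable_cst. Qed.

Lemma cmeas_real (f : T -> R) : measurable_fun setT f ->
  cmeas (fun x => (f x)%:C%C).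
Proof. by move=> mf; split => //; exact: measurable_cst. Qed.

Lemma cmeasM f g : cmeas f -> cmeas g -> cmeas (fun x => f x * g x).
Proof.
move=> [f1 f2] [g1 g2]; split.
  rewrite (_ : (fun x => _) = (fun x => complex.Re (f x) * complex.Re (g x) -
    complex.Im (f x) * complex.Im (g x))).
    by apply: measurable_funB; apply: measurable_funM.
  by apply/funext => x; case: (f x) (g x) => [a b] [c e].
rewrite (_ : (fun x => _) = (fun x => complex.Re (f x) * complex.Im (g x) +
    complex.Im (f x) * complex.Re (g x))).
  by apply: measurable_funD; apply: measurable_funM.
by apply/funext => x; case: (f x) (g x) => [a b] [c e].
Qed.

Lemma cmeasD f g : cmeas f -> cmeas g -> cmeas (fun x => f x + g x).
Proof.
move=> [f1 f2] [g1 g2]; split.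
  rewrite (_ : (fun x => _) = (fun x => complex.Re (f x) + complex.Re (g x))).
    exact: measurable_funD.
  by apply/funext => x; case: (f x) (g x) => [a b] [c e].
rewrite (_ : (fun x => _) = (fun x => complex.Im (f x) + complex.Im (g x))).
  exact: measurable_funD.
by apply/funext => x; case: (f x) (g x) => [a b] [c e].
Qed.

Lemma cmeas_conj f : cmeas f -> cmeas (fun x => (f x)^*).
Proof.
move=> [f1 f2]; split.
  by rewrite (_ : (fun x => _) = (fun x => complex.Re (f x)))//;
     apply/funext => x; case: (f x).
rewrite (_ : (fun x => _) = (fun x => - complex.Im (f x)));
  first exact: measurable_funN.
by apply/funext => x; case: (f x).
Qed.

Lemma cmeas_sum (I : Type) (r : seq I) (F : I -> T -> C) :
  (forall i, cmeas (F i)) -> cmeas (fun x => \sum_(i <- r) F i x).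
Proof.
move=> mF; elim: r => [|i r IH].
  by under eq_fun do rewrite big_nil; exact: cmeas_cst.
by under eq_fun do rewrite big_cons; exact: cmeasD.
Qed.

Lemma cmeas_prod (I : Type) (r : seq I) (F : I -> T -> C) :
  (forall i, cmeas (F i)) -> cmeas (fun x => \prod_(i <- r) F i x).
Proof.
move=> mF; elim: r => [|i r IH].
  by under eq_fun do rewrite big_nil; exact: cmeas_cst.
by under eq_fun do rewrite big_cons; exact: cmeasM.
Qed.

Lemma measurable_normc f : cmeas f ->
  measurable_fun setT (fun x => normc (f x)).
Proof.
move=> [f1 f2]; under eq_fun do rewrite normc_sqrtE.
apply: (measurableT_comp (f := @Num.sqrt R)).
  by apply: continuous_measurable_fun; exact: sqrt_continuous.
by apply: measurable_funD; apply: measurable_funX.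
Qed.

(** The condition of [measurable_mx], for rectangular matrices. *)
Definition mmeas p q (M : T -> 'M[C]_(p, q)) :=
  forall i j, cmeas (fun x => M x i j).

Lemma mmeas_cst p q (M : 'M[C]_(p, q)) : mmeas (fun=> M).
Proof. by move=> i j; exact: cmeas_cst. Qed.

Lemma mmeasM p q r (M : T -> 'M[C]_(p, q)) (N : T -> 'M[C]_(q, r)) :
  mmeas M -> mmeas N -> mmeas (fun x => M x *m N x).
Proof.
move=> mM mN i j; under eq_fun do rewrite mxE.
by apply: cmeas_sum => k; exact: cmeasM.
Qed.

Lemma mmeas_adj p q (M : T -> 'M[C]_(p, q)) : mmeas M ->
  mmeas (fun x => (M x) ^t*).
Proof. by move=> mM i j; under eq_fun do rewrite !mxE; exact: cmeas_conj. Qed.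

Lemma cmeas_det p (M : T -> 'M[C]_p) : mmeas M -> cmeas (fun x => \det (M x)).
Proof.
move=> mM; apply: cmeas_sum => s; apply: cmeasM; first exact: cmeas_cst.
exact: cmeas_prod.
Qed.

Lemma mmeas_pow p (M : T -> 'M[C]_p) n : mmeas M -> mmeas (fun x => M x ^+ n).
Proof.
move=> mM; elim: n => [|n IH]; first exact: mmeas_cst.
by under eq_fun do rewrite exprS -mulmxE; exact: mmeasM.
Qed.

Lemma mmeas_extpow p k (M : T -> 'M[C]_p) : mmeas M ->
  mmeas (fun x => extpow k (M x)).
Proof.
move=> mM I J; under eq_fun do rewrite mxE.
by apply: cmeas_det => i j; under eq_fun do rewrite mxE; exact: mM.
Qed.

Lemma measurable_frob2 p q (M : T -> 'M[C]_(p, q)) : mmeas M ->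
  measurable_fun setT (fun x => frob2 (M x)).
Proof.
move=> mM; apply: measurable_sum => i; apply: measurable_sum => j.
by apply: measurable_funX; exact: measurable_normc.
Qed.

Lemma measurable_extfrob2 p k (M : T -> 'M[C]_p) : mmeas M ->
  measurable_fun setT (fun x => extfrob2 k (M x)).
Proof. by move=> mM; apply: measurable_frob2; exact: mmeas_extpow. Qed.

Lemma measurable_lnT (g : T -> R) : measurable_fun setT g ->
  measurable_fun setT (fun x => ln (g x)).
Proof. by move=> mg; apply: (measurableT_comp (f := @ln R)) => //;
  exact: measurable_ln. Qed.

Variable d : nat.

(** The determinant formula replaces the sorted singular values by the modulus of a polynomial in
    the entries. *)
Lemma measurable_Nsum (M : T -> 'M[C]_(d + d)) : mmeas M ->
  (forall x, HSp (M x)) ->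
  measurable_fun setT (fun x => Nsum d (M x)).
Proof.
move=> mM MH; under eq_fun do rewrite Nsum_ln_det//.
apply/measurable_lnT/measurable_normc/cmeas_det => i j.
have mcay : mmeas (fun x => cay (M x)).
  move=> a b; rewrite /cay; under eq_fun do rewrite mxE.
  apply: cmeasM; first exact: cmeas_cst.
  by apply: mmeasM; [apply: mmeasM => //|]; exact: mmeas_cst.
rewrite (_ : (fun x => _) = (fun x => cay (M x) (rshift d i) (rshift d j)));
  first exact: mcay.
by apply/funext => x; rewrite !mxE.
Qed.

(* [sigprod2 k] is the limit of [extfrob2 k ((M^* M)^n) ^ (1 / 2n)], in which
   only polynomials in the entries of [M] occur. *)
Lemma measurable_ln_sigprod2 (M : T -> 'M[C]_(d + d)) k : mmeas M ->
  (forall x, HSp (M x)) -> (k <= d)%N ->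
  measurable_fun setT (fun x => ln (sigprod2 k (M x))).
Proof.
move=> mM MH kd; have kdd : (k <= d + d)%N by rewrite (leq_trans kd) ?leq_addr.
pose h n x := (n.+1 + n.+1)%:R^-1 *
  ln (extfrob2 k (((M x) ^t* *m M x) ^+ n.+1)).
apply: (@measurable_fun_cvg _ _ _ _ h).
  move=> n; apply: measurable_funM; first exact: measurable_cst.
  apply/measurable_lnT/measurable_extfrob2/mmeas_pow; apply: mmeasM => //.
  exact: mmeas_adj.
move=> x _; set l := ln (sigprod2 k (M x));
  pose c := ln #|ltn_tuples k (d + d)|%:R : R.
have s0 : 0 < sigprod2 k (M x)
  by rewrite (lt_le_trans ltr01)// HSp_sigprod2_ge1.
have c1 : 0 < #|ltn_tuples k (d + d)|%:R :> R
  by rewrite ltr0n card_ltn_tuples_gt0.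
have cl : (n.+1 + n.+1)%:R^-1 * c @[n --> \oo] --> (0 : R).
  under eq_fun do rewrite addnn -mul2n natrM invfM -mulrA.
  rewrite -(mulr0 2^-1); apply: cvgMr; rewrite -(mul0r c); apply: cvgMl.
  exact: cvg_harmonic.
have hi : l + (n.+1 + n.+1)%:R^-1 * c @[n --> \oo] --> l.
  by rewrite -[X in _ --> X]addr0; apply: cvgD => //; exact: cvg_cst.
apply: (squeeze_cvgr _ (cvg_cst l) hi); apply: nearW => n.
have /andP[lo' hi'] := extfrob2_gram_pow (M x) n.+1 kdd.
have n0 : 0 < (n.+1 + n.+1)%:R :> R by rewrite ltr0n.
have e0 : 0 < extfrob2 k (((M x) ^t* *m M x) ^+ n.+1).
  by apply: lt_le_trans lo'; rewrite exprn_gt0.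
apply/andP; split.
  by rewrite ler_pdivlMl// mulr_natl -lnXn// ler_ln ?posrE ?exprn_gt0.
rewrite ler_pdivrMl// mulrDr mulVKf ?gt_eqF// mulr_natl -lnXn// addrC.
by rewrite -lnM ?posrE ?exprn_gt0// ler_ln ?posrE ?mulr_gt0 ?exprn_gt0.
Qed.

Lemma ln_singval_sigprod2 (M : 'M[C]_(d + d)) k : HSp M -> (k < d)%N ->
  ln (singval M k) = 2^-1 * ln (sigprod2 k.+1 M) - 2^-1 * ln (sigprod2 k M).
Proof.
move=> MH kd; have s0 : 0 < singval M k
  by rewrite (lt_le_trans ltr01)// HSp_singval_ge1.
have p0 : 0 < sigprod2 k M
  by rewrite (lt_le_trans ltr01)// HSp_sigprod2_ge1// ltnW.
rewrite -mulrBr [sigprod2 k.+1 M]big_ord_recr /= -/(sigprod2 k M).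
rewrite lnM ?posrE ?exprn_gt0// addrC addKr lnXn// -(mulr_natl (ln _)) mulKf//.
Qed.

(** Carries integrability of [ln (opnorm M)] over to exterior powers: each of the [2 k] factors of
    [sigprod2 k M] is at most the largest singular value, itself bounded by [d + d] times
    [opnorm M]. *)
Lemma HSp_ln_extfrob2_opnorm (M : 'M[C]_(d + d)) k : (0 < d)%N -> HSp M ->
  (k <= d)%N ->
  ln (extfrob2 k M) <= ln #|ltn_tuples k (d + d)|%:R +
    (2 * k)%:R * (ln (d + d)%:R + ln (opnorm M)).
Proof.
move=> d0 MH kd; have /andP[_ le] := HSp_ln_extfrob2_sigprod2 MH kd.
apply: (le_trans le); rewrite lerD2l.
have dd0 : (0 < d + d)%N by rewrite addn_gt0 d0.
have sle := singval0_le_opnorm M dd0.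
have s1 : 1 <= singval M 0 := HSp_singval_ge1 MH d0.
have s0 : 0 < singval M 0 := lt_le_trans ltr01 s1.
have dR : 0 < (d + d)%:R :> R by rewrite ltr0n.
have o0 : 0 < opnorm M.
  by have := lt_le_trans s0 sle; rewrite pmulr_rgt0.
rewrite -lnM ?posrE// mulr_natl -lnXn ?mulr_gt0//.
rewrite ler_ln ?posrE ?exprn_gt0 ?mulr_gt0//; last first.
  by rewrite (lt_le_trans ltr01)// HSp_sigprod2_ge1.
rewrite exprM -[X in _ <= _ ^+ X]card_ord -prodr_const; apply: ler_prod => i _.
rewrite exprn_ge0 ?singval_ge0//= lerXn2r// ?nnegrE ?singval_ge0//.
  by rewrite mulr_ge0// ltW.
by apply: le_trans sle; exact: singval_le.
Qed.

End ComplexMeasurability.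

(** * Lyapunov exponents *)

Section MeasurePreserving.
Variables (R : realType) (dX : measure_display) (X : measurableType dX).
Variables (mu : probability X R) (f : X -> X).
Hypothesis mp : measure_preserving mu f.

Lemma measurable_iter n : measurable_fun setT (iter n f).
Proof.
elim: n => [|n IH]; first exact: measurable_id.
by apply: (measurableT_comp _ IH); case: mp.
Qed.

(** Invariance of the integral, applied to the integrable function [|g|], bounds the integral of
    [|g \o f|]. *)
Lemma integrable_comp (g : X -> R) : mu.-integrable setT (EFin \o g) ->
  mu.-integrable setT (EFin \o (g \o f)).
Proof.
move=> ig; have [mf If] := mp; have /integrableP[mg ltg] := ig.
apply/integrableP; split.
  exact: (measurableT_comp mg mf).
have iabs : mu.-integrable setT (EFin \o (fun x => `|g x|)).
  exact: (integrable_abse ig).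
by rewrite -[ltLHS]/(\int[mu]_x ((fun y => `|g y|) (f x))%:E)%E If.
Qed.

Lemma Rintegral_comp (g : X -> R) : mu.-integrable setT (EFin \o g) ->
  \int[mu]_x g (f x) = \int[mu]_x g x.
Proof. by move=> ig; rewrite /Rintegral (mp.2 g ig). Qed.

Lemma integrable_comp_iter (g : X -> R) n : mu.-integrable setT (EFin \o g) ->
  mu.-integrable setT (EFin \o (g \o iter n f)).
Proof.
elim: n g => [//|n IH] g ig; have := IH _ (integrable_comp ig).
by [].
Qed.

Lemma Rintegral_comp_iter (g : X -> R) n : mu.-integrable setT (EFin \o g) ->
  \int[mu]_x g (iter n f x) = \int[mu]_x g x.
Proof.
move=> ig; elim: n => [//|n IH]; rewrite -[RHS]IH.
rewrite -[RHS](Rintegral_comp (integrable_comp_iter n ig)).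
by apply: eq_Rintegral => x _ /=; rewrite -iterSr.
Qed.

Lemma integrable_cst (c : R) : mu.-integrable setT (EFin \o cst c).
Proof. exact: finite_measure_integrable_cst. Qed.

Lemma Rintegral_cst_prob (c : R) : \int[mu]_x c = c.
Proof.
by rewrite -[RHS]mulr1 Rintegral_cst//= probability_setT.
Qed.

Lemma EFin_Rintegral (g : X -> R) : mu.-integrable setT (EFin \o g) ->
  (\int[mu]_x (g x)%:E)%E = (\int[mu]_x g x)%:E.
Proof. by move=> ig; rewrite /Rintegral fineK//; exact: integrable_fin_num. Qed.

Lemma integrableR_D (g h : X -> R) : mu.-integrable setT (EFin \o g) ->
  mu.-integrable setT (EFin \o h) ->
  mu.-integrable setT (EFin \o (fun x => g x + h x)).
Proof. by move=> ig ih; have := integrableD measurableT ig ih. Qed.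

Lemma integrableR_B (g h : X -> R) : mu.-integrable setT (EFin \o g) ->
  mu.-integrable setT (EFin \o h) ->
  mu.-integrable setT (EFin \o (fun x => g x - h x)).
Proof. by move=> ig ih; have := integrableB measurableT ig ih. Qed.

Lemma integrableR_Z c (g : X -> R) : mu.-integrable setT (EFin \o g) ->
  mu.-integrable setT (EFin \o (fun x => c * g x)).
Proof. by move=> ig; have := integrableZl measurableT c ig. Qed.

Lemma integrable_bounded_by (g h : X -> R) : measurable_fun setT g ->
  (forall x, 0 <= g x <= h x) -> mu.-integrable setT (EFin \o h) ->
  mu.-integrable setT (EFin \o g).
Proof.
move=> mg gh ih; apply: (le_integrable _ _ _ ih) => //;
  first exact/measurable_EFinP.
move=> x _ /=; have /andP[g0 gle] := gh x.
by rewrite lee_fin ger0_norm// (le_trans gle)// ler_norm.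
Qed.

Lemma integrable_sum_fun n (g : nat -> X -> R) :
  (forall i, mu.-integrable setT (EFin \o g i)) ->
  mu.-integrable setT (EFin \o (fun x => \sum_(i < n) g i x)).
Proof.
move=> ig; elim: n => [|n IH].
  by under [X in EFin \o X]eq_fun do rewrite big_ord0; exact: integrable_cst.
under [X in EFin \o X]eq_fun do rewrite big_ord_recr /=.
exact: integrableR_D.
Qed.

Lemma integrable_birkhoff n (g : X -> R) : mu.-integrable setT (EFin \o g) ->
  mu.-integrable setT (EFin \o (fun x => \sum_(i < n) g (iter i f x))).
Proof.
move=> ig; apply: (integrable_sum_fun n (g := fun i x => g (iter i f x))) => i.
exact: integrable_comp_iter.
Qed.

Lemma Rintegral_birkhoff n (g : X -> R) : mu.-integrable setT (EFin \o g) ->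
  \int[mu]_x (\sum_(i < n) g (iter i f x)) = n%:R * \int[mu]_x g x.
Proof.
move=> ig; elim: n => [|n IH].
  by under eq_Rintegral do rewrite big_ord0; rewrite Rintegral_cst_prob mul0r.
under eq_Rintegral do rewrite big_ord_recr /=.
have ign := integrable_comp_iter n ig.
rewrite (RintegralD _ (integrable_birkhoff n ig) ign)// IH mulrSr mulrDl mul1r.
by rewrite -(Rintegral_comp_iter n ig).
Qed.

Lemma Rintegral_close (g h : X -> R) c : mu.-integrable setT (EFin \o g) ->
  mu.-integrable setT (EFin \o h) -> (forall x, `|g x - h x| <= c) ->
  `|\int[mu]_x g x - \int[mu]_x h x| <= c.
Proof.
move=> ig ih gh; rewrite -RintegralB//.
have igh := integrableR_B ig ih.
apply: le_trans (le_normr_Rintegral _ igh) _ => //.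
rewrite -[leRHS]Rintegral_cst_prob; apply: le_Rintegral => //.
  exact: (integrable_abse igh).
exact: integrable_cst.
Qed.

End MeasurePreserving.

(** * Existence of the exponents of a Hermitian-symplectic cocycle *)

Section Lyapunov.
Variables (R : realType) (d : nat).
Variables (dX : measure_display) (X : measurableType dX).
Variables (mu : probability X R) (f : X -> X).
Hypothesis mp : measure_preserving mu f.
Variable B : X -> 'M[R[i]]_(d + d).
Hypothesis BH : forall x, HSp (B x).
Hypothesis mB : mmeas B.
Hypothesis iB : forall k, (k <= d)%N ->
  mu.-integrable setT (EFin \o (fun x => ln (extfrob2 k (B x)))).

Lemma HSp_cocycle n x : HSp (cocycle f B n x).
Proof. by elim: n => [|n IH] /=; [exact: HSp1|exact: HSpM]. Qed.

Lemma mmeas_comp (g : X -> X) : measurable_fun setT g ->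
  mmeas (fun x => B (g x)).
Proof.
move=> mg i j; have [mr mi] := mB i j; split.
  exact: (measurableT_comp mr mg).
exact: (measurableT_comp mi mg).
Qed.

Lemma mmeas_cocycle n : mmeas (cocycle f B n).
Proof.
elim: n => [|n IH]; first exact: mmeas_cst.
apply: mmeasM => //; apply: mmeas_comp; exact: (measurable_iter mp).
Qed.

Lemma cocycleD m n x :
  cocycle f B (m + n) x = cocycle f B m (iter n f x) *m cocycle f B n x.
Proof.
elim: m => [|m IH]; first by rewrite mul1mx.
by rewrite addSn /= IH mulmxA iterD.
Qed.

Lemma ln_extfrob2_cocycle_bounds k n x : (k <= d)%N ->
  0 <= ln (extfrob2 k (cocycle f B n x)) <=
  ln #|ltn_tuples k (d + d)|%:R + \sum_(i < n) ln (extfrob2 k (B (iter i f x))).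
Proof.
move=> kd; rewrite ln_ge0 ?HSp_extfrob2_ge1//=; last exact: HSp_cocycle.
elim: n => [|n IH]; first by rewrite big_ord0 addr0 ln_extfrob2_1.
rewrite /= big_ord_recr /=.
apply: le_trans (HSp_ln_extfrob2M (BH _) (HSp_cocycle _ _) kd) _.
by rewrite addrA [leRHS]addrC lerD2l.
Qed.

Lemma integrable_ln_extfrob2_cocycle k n : (k <= d)%N ->
  mu.-integrable setT (EFin \o (fun x => ln (extfrob2 k (cocycle f B n x)))).
Proof.
move=> kd; apply: integrable_bounded_by
  (fun x => ln_extfrob2_cocycle_bounds n x kd) _.
  exact/measurable_lnT/measurable_extfrob2/mmeas_cocycle.
apply: integrableR_D; first exact: integrable_cst.
exact: (integrable_birkhoff mp n (iB kd)).
Qed.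

Lemma integrable_ln_sigprod2_cocycle k n : (k <= d)%N ->
  mu.-integrable setT (EFin \o (fun x => ln (sigprod2 k (cocycle f B n x)))).
Proof.
move=> kd; apply: integrable_bounded_by (integrable_ln_extfrob2_cocycle n kd).
  apply: measurable_ln_sigprod2 => //; first exact: mmeas_cocycle.
  exact: HSp_cocycle.
move=> x; have CH := HSp_cocycle n x; rewrite ln_ge0 ?HSp_sigprod2_ge1//=.
by have /andP[] := HSp_ln_extfrob2_sigprod2 CH kd.
Qed.

Lemma integrable_Nsum_cocycle n :
  mu.-integrable setT (EFin \o (fun x => Nsum d (cocycle f B n x))).
Proof.
have CH := HSp_cocycle n.
apply: integrable_bounded_by (integrable_ln_sigprod2_cocycle n (leqnn d)).
  by apply: measurable_Nsum => //; exact: mmeas_cocycle.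
move=> x; rewrite HSp_Nsum_ge0//=; have /andP[le _] := HSp_sigprod2_Nsum (CH x).
apply: (le_trans le); rewrite ler_piMl ?invf_le1 ?ler1n//.
by rewrite ln_ge0// HSp_sigprod2_ge1.
Qed.

Let sig k n := \int[mu]_x ln (sigprod2 k (cocycle f B n x)).

(** Submultiplicativity of the Hilbert-Schmidt norms makes the integrals [a] subadditive, invariance
    of [mu] removing the shift [iter n f]. Passing to [sigprod2] changes them by a bounded amount
    only. *)
Lemma cvg_sigprod2_cocycle k : (k <= d)%N ->
  exists l : R, n%:R^-1 * sig k n @[n --> \oo] --> l.
Proof.
move=> kd; pose a n := \int[mu]_x ln (extfrob2 k (cocycle f B n x)).
have ia n := integrable_ln_extfrob2_cocycle n kd.
have [l al] : exists l : R, n%:R^-1 * a n @[n --> \oo] --> l.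
  apply: Fekete => [n|m n].
    apply: Rintegral_ge0 => x _.
    by have /andP[] := ln_extfrob2_cocycle_bounds n x kd.
  rewrite /a -(Rintegral_comp_iter mp n (ia m)) -RintegralD//; last first.
    exact: (integrable_comp_iter mp n (ia m)).
  apply: le_Rintegral => //.
    exact: (integrableR_D (integrable_comp_iter mp n (ia m)) (ia n)).
  move=> x _; rewrite cocycleD; apply: HSp_ln_extfrob2M => //;
    exact: HSp_cocycle.
exists l; apply: (@cvg_invn_close _ a _ (ln #|ltn_tuples k (d + d)|%:R)) al =>
  n.
apply: Rintegral_close => //; first exact: integrable_ln_sigprod2_cocycle.
move=> x; have /andP[lo hi] := HSp_ln_extfrob2_sigprod2 (HSp_cocycle n x) kd.
by rewrite ger0_norm ?subr_ge0// lerBlDr.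
Qed.

(** The square of the singular value of index [k] is the quotient of consecutive [sigprod2], so the
    sequence under [limn] is half a difference of two convergent ones. *)
Lemma lyap_sigprod2 k l l' : (k < d)%N ->
  n%:R^-1 * sig k n @[n --> \oo] --> (l : R) ->
  n%:R^-1 * sig k.+1 n @[n --> \oo] --> (l' : R) ->
  lyap mu f B k = (2^-1 * l' - 2^-1 * l)%:E.
Proof.
move=> kd kl kl'; apply: (cvg_lim (@ereal_hausdorff R)).
pose c n := 2^-1 * (n%:R^-1 * sig k.+1 n) - 2^-1 * (n%:R^-1 * sig k n).
have is1 n := integrable_ln_sigprod2_cocycle n kd.
have is0 n := integrable_ln_sigprod2_cocycle n (ltnW kd).
rewrite (_ : (fun n => _) = EFin \o c).
  apply: cvg_EFin; first exact: nearW.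
  by apply: cvgB; apply: cvgMr.
apply/funext => n; rewrite /c /sig.
have E x : ln (singval (cocycle f B n x) k) =
    2^-1 * ln (sigprod2 k.+1 (cocycle f B n x)) - 2^-1 *
      ln (sigprod2 k (cocycle f B n x)).
  by rewrite ln_singval_sigprod2//; exact: HSp_cocycle.
under eq_integral do rewrite E.
rewrite EFin_Rintegral; last by apply: integrableR_B; exact: integrableR_Z.
rewrite -EFinM /=; congr EFin.
rewrite RintegralB//; [|exact: integrableR_Z|exact: integrableR_Z].
rewrite !RintegralZl//; ring.
Qed.

(** The differences telescope; the factor 1/2 compensates the squares in [sigprod2]. *)
Lemma lyapsum_sigprod2 k : (k <= d)%N -> exists2 l : R,
  n%:R^-1 * sig k n @[n --> \oo] --> l & lyapsum mu f B k = (2^-1 * l)%:E.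
Proof.
elim: k => [|k IH] kd.
  exists 0; last by rewrite /lyapsum big_ord0 mulr0.
  rewrite (_ : (fun n => _) = cst 0); first exact: cvg_cst.
  apply/funext => n; rewrite /sig;
    under eq_Rintegral do rewrite /sigprod2 big_ord0 ln1.
  by rewrite Rintegral_cst_prob mulr0.
have [l kl E] := IH (ltnW kd); have [l' kl'] := cvg_sigprod2_cocycle kd.
exists l' => //; rewrite /lyapsum big_ord_recr /= -/(lyapsum mu f B k) E.
by rewrite (lyap_sigprod2 kd kl kl') -EFinD addrC subrK.
Qed.

(** Indexed by [n.+1], so that the division is genuine in every term, as the exact averages [int_g]
    require. *)
Lemma cvg_lyapsum :
  (n.+1%:R^-1%:E * \int[mu]_x (Nsum d (cocycle f B n.+1 x))%:E)%E @[n --> \oo]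
    --> lyapsum mu f B d.
Proof.
have [l sl ->] := lyapsum_sigprod2 (leqnn d).
pose b n := \int[mu]_x Nsum d (cocycle f B n x).
have iN := integrable_Nsum_cocycle;
  have is1 n := integrable_ln_sigprod2_cocycle n (leqnn d).
have bl : n%:R^-1 * b n @[n --> \oo] --> 2^-1 * l.
  apply: (@cvg_invn_close _ (fun n => 2^-1 * sig d n) _ (d%:R * ln 2));
    last first.
    under eq_fun do rewrite mulrCA; exact: cvgMr.
  move=> n; rewrite /sig -RintegralZl//; apply: Rintegral_close => //.
    exact: integrableR_Z.
  move=> x; have /andP[lo hi] := HSp_sigprod2_Nsum (HSp_cocycle n x).
  by rewrite ger0_norm ?subr_ge0// lerBlDl.
have bl1 : n.+1%:R^-1 * b n.+1 @[n --> \oo] --> 2^-1 * l.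
  have := cvg_shiftS (fun n => n%:R^-1 * b n) (nbhs (2^-1 * l)).
  by move=> /= ->.
have bE n : (\int[mu]_x (Nsum d (cocycle f B n x))%:E = (b n)%:E)%E.
  by rewrite EFin_Rintegral.
under eq_fun do rewrite bE -EFinM.
clearbody b; apply: cvg_EFin; first exact: nearW.
exact: bl1.
Qed.

End Lyapunov.

(** * Averaging over the rotation angle *)

Section TonelliRestricted.
Variables (R : realType) (d1 d2 : measure_display).
Variables (T1 : measurableType d1) (T2 : measurableType d2).
Variables (m1 : {sigma_finite_measure set T1 -> \bar R}).
Variables (m2 : {sigma_finite_measure set T2 -> \bar R}).

(** The indicator of [D] is moved into the integrand, which reduces to Tonelli's theorem on the full
    product. *)
Lemma fubini_tonelli_in (D : set T1) (h : T1 * T2 -> R) : measurable D ->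
  measurable_fun setT h -> (forall z, 0 <= h z) ->
  (\int[m1]_(y in D) \int[m2]_x (h (y, x))%:E =
   \int[m2]_x \int[m1]_(y in D) (h (y, x))%:E)%E.
Proof.
move=> mD mh h0; rewrite integral_mkcond.
pose k (z : T1 * T2) := (\1_D z.1 * h z)%:E.
have kE y x : k (y, x) = ((fun y => (h (y, x))%:E) \_ D) y.
  by rewrite /k patchE indicE /=; case: ifPn => yD; rewrite ?mul1r ?mul0r.
transitivity (\int[m1]_y \int[m2]_x k (y, x))%E.
  apply: eq_integral => y _; rewrite patchE; case: ifPn => yD.
    by apply: eq_integral => x _; rewrite kE patchE yD.
  rewrite (eq_integral (cst 0%E)) ?integral0// => x _.
  by rewrite kE patchE (negPf yD).
rewrite fubini_tonelli.
- by apply: eq_integral => x _; rewrite [RHS]integral_mkcond;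
    apply: eq_integral => y _.
- apply/measurable_EFinP; apply: measurable_funM => //.
  apply: (measurableT_comp (f := \1_D : T1 -> R)); last exact: measurable_fst.
  exact: measurable_indic.
- by move=> z; rewrite lee_fin mulr_ge0// indicE.
Qed.

Lemma measurable_integral_snd (h : T1 * T2 -> R) :
  measurable_fun setT h -> (forall z, 0 <= h z) ->
  measurable_fun setT (fun y => \int[m2]_x (h (y, x))%:E)%E.
Proof.
move=> mh h0; apply: (@measurable_fun_fubini_tonelli_F _ _ _ _ R m2 (EFin \o h))
  => //.
exact/measurable_EFinP.
Qed.

End TonelliRestricted.

Section BlockMeasurability.
Variables (R : realType) (dT : measure_display) (T : measurableType dT).

Lemma mmeas_block m1 m2 n1 n2 (a : T -> 'M[R[i]]_(m1, n1))
  (b : T -> 'M[R[i]]_(m1, n2))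
    (c : T -> 'M[R[i]]_(m2, n1)) (e : T -> 'M[R[i]]_(m2, n2)) :
  mmeas a -> mmeas b -> mmeas c -> mmeas e ->
  mmeas (fun x => block_mx (a x) (b x) (c x) (e x)).
Proof.
move=> ma mb mc me i j; rewrite -(splitK i) -(splitK j).
case: (fintype.split i) => k; case: (fintype.split j) => l /=.
- by under eq_fun do rewrite block_mxEul.
- by under eq_fun do rewrite block_mxEur.
- by under eq_fun do rewrite block_mxEdl.
- by under eq_fun do rewrite block_mxEdr.
Qed.

End BlockMeasurability.

(** * The limit under the angular average *)

Section AveragedLyapunov.
Variables (R : realType) (d : nat).
Hypothesis d_gt0 : (0 < d)%N.
Variables (dX : measure_display) (X : measurableType dX).
Variables (mu : probability X R) (f : X -> X) (A : X -> 'M[R[i]]_(d + d)).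
Hypothesis mp : measure_preserving mu f.
Hypothesis AH : forall x, HSp (A x).
Hypothesis mA : measurable_mx A.
Hypothesis iA : mu.-integrable setT (fun x => (ln (opnorm (A x)))%:E).
Notation leb := (@lebesgue_measure R).

(** Listed from the latest time down, because the cocycle multiplies new factors on the left. *)
Definition orbit_seq n x := [seq A (iter j f x) | j <- rev (iota 0 n)].

Lemma orbit_seqS n x : orbit_seq n.+1 x = A (iter n f x) :: orbit_seq n x.
Proof. by rewrite /orbit_seq -addn1 iotaD rev_cat. Qed.

Lemma hsp_orbit_seq n x : hsp_seq (orbit_seq n x).
Proof. by move=> T /mapP[j _ ->]. Qed.

Lemma cocycle_rotmx theta n x :
  cocycle f (fun x => rotmx d theta *m A x) n x = rotprod theta (orbit_seq n x).
Proof.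
rewrite /rotprod; elim: n => [|n IH]; first by rewrite big_nil.
by rewrite orbit_seqS big_cons /= IH.
Qed.

Lemma sum_orbit_seq n x (F : 'M[R[i]]_(d + d) -> R) :
  \sum_(T <- orbit_seq n x) F T = \sum_(j < n) F (A (iter j f x)).
Proof.
elim: n => [|n IH]; first by rewrite big_nil big_ord0.
by rewrite orbit_seqS big_cons IH big_ord_recr addrC.
Qed.

Lemma integrable_ln_extfrob2 k : (k <= d)%N ->
  mu.-integrable setT (EFin \o (fun x => ln (extfrob2 k (A x)))).
Proof.
move=> kd; apply: (integrable_bounded_by (h := fun x =>
    ln #|ltn_tuples k (d + d)|%:R + (2 * k)%:R *
      (ln (d + d)%:R + ln (opnorm (A x))))).
- exact/measurable_lnT/measurable_extfrob2/mA.
- move=> x; rewrite ln_ge0 ?HSp_extfrob2_ge1//=.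
  exact: HSp_ln_extfrob2_opnorm.
apply: integrableR_D; first exact: integrable_cst.
apply: integrableR_Z; apply: integrableR_D => //; exact: integrable_cst.
Qed.

Let B theta x := rotmx d theta *m A x.

Let BH theta x : HSp (B theta x).
Proof. by apply: HSpM => //; exact: HSp_rotmx. Qed.

Let mB theta : mmeas (B theta).
Proof. by apply: mmeasM; [exact: mmeas_cst|exact: mA]. Qed.

Let iB theta k : (k <= d)%N ->
  mu.-integrable setT (EFin \o (fun x => ln (extfrob2 k (B theta x)))).
Proof.
move=> kd; under [X in EFin \o X]eq_fun do rewrite /B extfrob2_rot.
exact: integrable_ln_extfrob2.
Qed.

Let h n (z : measurableTypeR R * X) := Nsum d (rotprod z.1 (orbit_seq n z.2)).

Let h_ge0 n z : 0 <= h n z.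
Proof. by apply: HSp_Nsum_ge0; apply: HSp_rotprod; exact: hsp_orbit_seq. Qed.

Lemma mmeas_rotmx :
  mmeas (fun z : measurableTypeR R * X => rotmx d z.1).
Proof.
have mcs (F : R -> R) : continuous F ->
    cmeas (fun z : measurableTypeR R * X => (F (pi * z.1))%:C%C).
  move=> cF; apply: cmeas_real; apply: (measurableT_comp (f := F)).
    exact: continuous_measurable_fun.
  by apply: measurable_funM; [exact: measurable_cst|exact: measurable_fst].
have mc := mcs _ (@continuous_cos R); have ms := mcs _ (@continuous_sin R).
have msc (F : measurableTypeR R * X -> R[i]) : cmeas F ->
    mmeas (fun z => (F z)%:M : 'M[R[i]]_d).
  move=> mF i j; under eq_fun do rewrite mxE -mulr_natl.
  by apply: cmeasM => //; exact: cmeas_cst.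
under eq_fun do rewrite rotmxE /sblock.
apply: mmeas_block; apply: msc => //.
by under eq_fun do rewrite -mulN1r; apply: cmeasM => //; exact: cmeas_cst.
Qed.

Lemma mmeas_rotprod_orbit n :
  mmeas (fun z : measurableTypeR R * X => rotprod z.1 (orbit_seq n z.2)).
Proof.
elim: n => [|n IH].
  under eq_fun do rewrite /rotprod big_nil; exact: mmeas_cst.
under eq_fun do rewrite orbit_seqS /rotprod big_cons.
apply: mmeasM IH; apply: mmeasM; first exact: mmeas_rotmx.
move=> i j; have [mr mi] := mA i j.
have mit : measurable_fun setT (fun z : measurableTypeR R * X => iter n f z.2).
  by apply: (measurableT_comp (measurable_iter mp n)); exact: measurable_snd.
split; first exact: (measurableT_comp mr mit).
exact: (measurableT_comp mi mit).
Qed.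

Let mh n : measurable_fun setT (h n).
Proof.
apply: measurable_Nsum; first exact: mmeas_rotprod_orbit.
by move=> z; apply: HSp_rotprod; exact: hsp_orbit_seq.
Qed.

Let g n (theta : measurableTypeR R) :=
  (n.+1%:R^-1%:E * \int[mu]_x (h n.+1 (theta, x))%:E)%E.

Let cocycleE theta n x : Nsum d (cocycle f (B theta) n x) = h n (theta, x).
Proof. by rewrite /h /= -cocycle_rotmx. Qed.

Let gE n theta : g n theta =
  (n.+1%:R^-1%:E * \int[mu]_x (Nsum d (cocycle f (B theta) n.+1 x))%:E)%E.
Proof. by under eq_integral do rewrite cocycleE. Qed.

Let g_lyapsum theta : g n theta @[n --> \oo] --> lyapsum mu f (B theta) d.
Proof.
under eq_fun do rewrite gE.
exact: (cvg_lyapsum mp (@BH theta) (@mB theta) (@iB theta)).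
Qed.

Lemma integrable_Nsum : mu.-integrable setT (EFin \o (fun x => Nsum d (A x))).
Proof.
apply: integrable_bounded_by (integrable_ln_extfrob2 (leqnn d)).
  exact: measurable_Nsum.
move=> x; rewrite HSp_Nsum_ge0//=; have /andP[le _] := HSp_sigprod2_Nsum (AH x).
apply: (le_trans le);
  have /andP[le' _] := HSp_ln_extfrob2_sigprod2 (AH x) (leqnn d).
apply: le_trans le'; rewrite ler_piMl ?invf_le1 ?ler1n//.
by rewrite ln_ge0// HSp_sigprod2_ge1.
Qed.

(** Exact for every [n]: after exchanging the integrals, the angular average at fixed [x] is the sum
    of [Nsum d] along the orbit, and by invariance this sum integrates to [n.+1] times the integral
    of [Nsum d]. *)
Let int_g n : (\int[leb]_(theta in `[0%R, 1%R]) g n theta =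
  \int[mu]_x (Nsum d (A x))%:E)%E.
Proof.
rewrite /g ge0_integralZl//; first last.
- by move=> theta _; apply: integral_ge0 => x _; rewrite lee_fin.
- apply: measurable_funTS.
  exact: (@measurable_integral_snd R _ _ _ _ mu (h n.+1)).
rewrite fubini_tonelli_in//.
under eq_integral => x _.
  rewrite /h /= integral_Nsum_rotprod; last exact: hsp_orbit_seq.
  rewrite sum_orbit_seq; over.
rewrite (EFin_Rintegral (integrable_birkhoff mp n.+1 integrable_Nsum)).
rewrite EFin_Rintegral; last exact: integrable_Nsum.
rewrite -EFinM; congr EFin;
  rewrite (Rintegral_birkhoff mp n.+1 integrable_Nsum).
by rewrite mulKf// pnatr_eq0.
Qed.

(** Uniform in both arguments: the bound on [Nsum d] is a sum over the orbit without [theta], and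
    its normalized integral is the same for all [n] by invariance. *)
Let g_bound n theta : (`|g n theta| <= (\int[mu]_x ln (extfrob2 d (A x)))%:E)%E.
Proof.
have iE := integrable_ln_extfrob2 (leqnn d).
rewrite gee0_abs; last first.
  by rewrite mule_ge0 ?lee_fin ?invr_ge0// integral_ge0// => x _;
    rewrite lee_fin.
rewrite gE.
have iN := integrable_Nsum_cocycle mp (@BH theta) (@mB theta) (@iB theta) n.+1.
rewrite EFin_Rintegral// -EFinM lee_fin ler_pdivrMl//.
rewrite -(Rintegral_birkhoff mp n.+1 iE).
apply: (le_Rintegral measurableT iN (integrable_birkhoff mp n.+1 iE)) => x _.
rewrite cocycleE /h /=;
  apply: le_trans (Nsum_rotprod_le _ (@hsp_orbit_seq n.+1 x) _) _.
  by rewrite orbit_seqS.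
rewrite sum_orbit_seq ler_piMl ?invf_le1 ?ler1n//; apply: sumr_ge0 => j _.
by rewrite ln_ge0// HSp_extfrob2_ge1.
Qed.

Theorem integral_lyapsum_rotmx :
  (\int[leb]_(theta in `[0%R, 1%R]) lyapsum mu f (fun x => rotmx d theta *m A x)
    d
   = \int[mu]_x (Nsum d (A x))%:E)%E.
Proof.
set K := \int[mu]_x ln (extfrob2 d (A x)).
have dc : (\int[leb]_(theta in `[0%R, 1%R]) g n theta)%E @[n --> \oo] -->
    (\int[leb]_(theta in `[0%R, 1%R]) lyapsum mu f (B theta) d)%E.
  apply: (@dominated_cvg _ _ R leb _ _ _ _ (cst K%:E)) => //.
  - move=> n; apply: measurable_funTS; apply: measurable_funeM.
    exact: (@measurable_integral_snd R _ _ _ _ mu (h n.+1)).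
  - by apply: continuous_itv_integrable; exact: cst_continuous.
rewrite -(cvg_lim (@ereal_hausdorff R) dc).
under eq_fun do rewrite int_g.
exact: lim_cst.
Qed.

End AveragedLyapunov.

Theorem theorem1p4 (R : realType) (d : nat) (d_gt0 : (0 < d)%N) :
  (forall (dX : measure_display) (X : measurableType dX)
      (mu : probability X R) (f : X -> X) (A : X -> 'M[R[i]]_(d + d)),
    measure_preserving mu f ->
    (forall x, HSp (A x)) ->
    measurable_mx A ->
    mu.-integrable setT (fun x => (ln (opnorm (A x)))%:E) ->
    (\int[lebesgue_measure]_(theta in `[0%R, 1%R])
        lyapsum mu f (fun x => rotmx d theta *m A x) d
     = \int[mu]_x (Nsum d (A x))%:E)%E)
  /\
  (forall (n : nat) (T : 'I_n -> 'M[R[i]]_(d + d)),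
    (1 <= n)%N ->
    (forall j, HSp (T j)) ->
    (\int[lebesgue_measure]_(theta in `[0%R, 1%R])
        (Nsum d (\big[mulmx/1%:M]_(j < n) (rotmx d theta *m T j)))%:E
     = (\sum_(j < n) Nsum d (T j))%:E)%E
    /\
    (\int[lebesgue_measure]_(theta in `[0%R, 1%R])
        (ln (specrad (extpow d
               (\big[mulmx/1%:M]_(j < n) (rotmx d theta *m T j)))))%:E
     = (\sum_(j < n) Nsum d (T j))%:E)%E).

Proof.
split=> [dX X mu f A mp AH mA iA|n T n1 TH].
  exact: (@integral_lyapsum_rotmx R d d_gt0 dX X mu f A mp AH mA iA).
pose s := [seq T j | j <- index_enum 'I_n].
have sH : hsp_seq s by move=> _ /mapP[j _ ->].
have s0 : (0 < size s)%N.
  have : T (Ordinal n1) \in s by rewrite map_f// mem_index_enum.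
  by case: (s).
have prodE theta :
    \big[mulmx/1%:M]_(j < n) (rotmx d theta *m T j) = rotprod theta s.
  by rewrite /rotprod big_map.
have sumE : \sum_(j < n) Nsum d (T j) = \sum_(M <- s) Nsum d M by rewrite big_map.
rewrite sumE; split.
  by under eq_integral do rewrite prodE; exact: integral_Nsum_rotprod.
by under eq_integral do rewrite prodE; exact: integral_ln_specrad_rotprod.
Qed.
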